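(* Assume the observation model $Y_{ij}=\mu_j+\epsilon_{ij}$, $i=1,\dots,m$, $j=1,\dots,d$, where the errors $\epsilon_{ij}$ are all drawn i.i.d. from the mixture $\pi\cdot N(-B,1)+(1-2\pi)\cdot N(0,1)+\pi\cdot N(B,1)$. Let $d$ and $m$ scale in such a manner that $(\log d)/m\to\infty$. Further, let $$\pi=\Big(\frac1d\Big)^{1/m},\qquad B=\sqrt{\frac{d^{1/m}}{2}},$$ so that the error variance is fixed at $\sigma^2=1+2\pi B^2=2$. Then under the global null hypothesis $\mu=0$, the unconditional TG statistic $$\mathcal T(Y;0)=\frac{1-\Phi\big(\sqrt m\,W_{(1)}/\sqrt2\big)}{1-\Phi\big(\sqrt m\,W_{(2)}/\sqrt2\big)}$$ does not converge in distribution to $U(0,1)$. In particular, on an event whose limiting probability is at least $1/e$, the statistic $\mathcal T(Y;0)$ converges to $0$. Further, the same results hold conditionally on any selected model: for any fixed $(j,s)$, the conditional TG statistic $T(Y;j,s,0)\mid\hat M(Y)=(j,s)$, where $$T(Y;j,s,0)=\frac{1-\Phi\big(\sqrt m\,s\bar Y_j/\sqrt2\big)}{1-\Phi\big(\max_{\ell\ne j}\sqrt m\,|\bar Y_\ell|/\sqrt2\big)},$$ does not converge in distribution to $U(0,1)$, and on an event with limiting probability (conditional on $\hat M(Y)=(j,s)$) at least $1/e$, it converges to $0$.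
   Context: $\Phi$ is the standard normal CDF. $\bar Y_j=\frac1m\sum_{i=1}^mY_{ij}$, $W_j=|\bar Y_j|$, and $W_{(1)}\ge\cdots\ge W_{(d)}$ are the order statistics of $W_1,\dots,W_d$. The selected model is $\hat M(Y)=(j,s)$, $j\in\{1,\dots,d\}$, $s\in\{-1,1\}$, if and only if $s\bar Y_j\ge\max_{\ell\ne j}|\bar Y_\ell|$. The limit is along sequences with $(\log d)/m\to\infty$ (so $d\to\infty$; $m\ge1$ need not diverge), with $d$ large enough that $2\pi\le1$. ''On an event with limiting probability at least $1/e$ the statistic converges to $0$'' means: there is a sequence of events $E$ (indexed along the sequence of $(d,m)$) whose probabilities have limit inferior at least $1/e$, such that for every $\varepsilon>0$ the probability of $E\cap\{\text{statistic}>\varepsilon\}$ tends to $0$ (with probabilities taken conditionally on $\hat M(Y)=(j,s)$ in the conditional statement). *)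

(* Defs.v *)
From HB Require Import structures.
From mathcomp Require Import all_boot all_order all_algebra.
From mathcomp Require Import all_classical all_reals all_analysis.

Set Implicit Arguments.
Unset Strict Implicit.
Unset Printing Implicit Defensive.

Import Order.TTheory GRing.Theory Num.Theory.
Import numFieldNormedType.Exports.

Local Open Scope classical_set_scope.
Local Open Scope ring_scope.

Definition mutually_independent (disp : measure_display)
    (T : measurableType disp) (R : realType) (P : probability T R)
    (I : finType) (X : I -> {RV P >-> R}) : Prop :=
  forall (J : {set I}) (A : I -> set R), (forall i, measurable (A i)) ->
    P (\bigcap_(i in [set` J]) (X i @^-1` A i)) =
    (\prod_(i in J) P (X i @^-1` A i))%E.

(* The value is irrelevant when [P B = 0]. *)
Definition cond_prob (disp : measure_display) (T : measurableType disp)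
    (R : realType) (P : probability T R) (B A : set T) : \bar R :=
  (fine (P (A `&` B)) / fine (P B))%:E.

(* [Q n] is the (possibly conditional) law on the [n]-th sample space, which is
   allowed to change with [n]; [L] is the limit law on the real line. *)
Definition cvg_in_distribution (R : realType) (T : nat -> Type)
    (Q : forall n, set (T n) -> \bar R) (X : forall n, T n -> R)
    (L : set R -> \bar R) : Prop :=
  forall x : R, {for x, continuous (fun t : R => L [set` `]-oo, t]])} ->
    Q n [set w | X n w <= x] @[n --> \oo] --> L [set` `]-oo, x]].

(* On some sequence of events with limiting probability at least [p],
   the nonnegative statistic [X] converges to 0 in probability. *)
Definition cvg0_on_event (R : realType) (disp : nat -> measure_display)
    (T : forall n, measurableType (disp n))
    (Q : forall n, set (T n) -> \bar R) (X : forall n, T n -> R)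
    (p : R) : Prop :=
  exists E : forall n, set (T n),
    [/\ forall n, measurable (E n),
        (p%:E <= limn_einf (fun n => Q n (E n)))%E
      & forall e : R, 0 < e ->
          Q n (E n `&` [set w | e < X n w]) @[n --> \oo] --> 0%E].

Definition unif01 (R : realType) : set R -> \bar R :=
  uniform_prob (@ltr01 R).

Definition Phi (R : realType) (x : R) : R :=
  fine (normal_prob 0 1 [set` `]-oo, x]]).

Definition mix_weight (R : realType) (m d : nat) : R :=
  (d%:R^-1) `^ (m%:R^-1).

Definition mix_shift (R : realType) (m d : nat) : R :=
  Num.sqrt (d%:R `^ (m%:R^-1) / 2).

Definition error_law (R : realType) (m d : nat) (A : set R) : \bar R :=
  let p := mix_weight R m d in
  let B := mix_shift R m d in
  (p%:E * normal_prob (- B) 1 A + (1 - 2 * p)%:E * normal_prob 0 1 A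
     + p%:E * normal_prob B 1 A)%E.

Definition iid_errors (disp : measure_display) (T : measurableType disp)
    (R : realType) (P : probability T R) (m d : nat)
    (eps : 'I_m -> 'I_d -> {RV P >-> R}) : Prop :=
  (forall i j (A : set R), measurable A ->
     distribution P (eps i j) A = error_law m d A) /\
  mutually_independent (fun ij : 'I_m * 'I_d => eps ij.1 ij.2).

Definition observations (disp : measure_display) (T : measurableType disp)
    (R : realType) (P : probability T R) (m d : nat) (mu : 'I_d -> R)
    (eps : 'I_m -> 'I_d -> {RV P >-> R}) (w : T) : 'M[R]_(m, d) :=
  \matrix_(i < m, j < d) (mu j + eps i j w).

Definition Ybar (R : realType) (m d : nat) (y : 'M[R]_(m, d)) (j : 'I_d) : R :=
  m%:R^-1 * \sum_(i < m) y i j.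

Definition W (R : realType) (m d : nat) (y : 'M[R]_(m, d)) (j : 'I_d) : R :=
  `|Ybar y j|.

(* [Word y k] is the [k]-th largest of the [W y j], counting from [k = 1]. *)
Definition Word (R : realType) (m d : nat) (y : 'M[R]_(m, d)) (k : nat) : R :=
  nth 0 (sort (fun a b : R => b <= a) [seq W y j | j <- enum 'I_d]) k.-1.

Definition TG (R : realType) (m d : nat) (y : 'M[R]_(m, d)) : R :=
  (1 - Phi (Num.sqrt m%:R * Word y 1 / Num.sqrt 2))
    / (1 - Phi (Num.sqrt m%:R * Word y 2 / Num.sqrt 2)).

(* The maxima below are over nonnegative families, hence the base value 0. *)
Definition selects (R : realType) (m d : nat) (y : 'M[R]_(m, d))
    (j : 'I_d) (s : R) : Prop :=
  \big[Num.max/0]_(l < d | l != j) `|Ybar y l| <= s * Ybar y j.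

Definition TG_selected (R : realType) (m d : nat) (j : 'I_d) (s : R)
    (y : 'M[R]_(m, d)) : R :=
  (1 - Phi (Num.sqrt m%:R * (s * Ybar y j) / Num.sqrt 2))
    / (1 - Phi ((\big[Num.max/0]_(l < d | l != j) (Num.sqrt m%:R * `|Ybar y l|))
                  / Num.sqrt 2)).

(* Main.v *)
Require Import Defs.
From HB Require Import structures.
From mathcomp Require Import all_boot all_order all_algebra.
From mathcomp Require Import all_classical all_reals all_analysis.
From mathcomp Require Import measurable_realfun.
From mathcomp Require Import ring lra.

Set Implicit Arguments.
Unset Strict Implicit.
Unset Printing Implicit Defensive.

Import Order.TTheory GRing.Theory Num.Theory.
Import numFieldNormedType.Exports.

Local Open Scope classical_set_scope.
Local Open Scope ring_scope.

(* Let S_j be the j-th column sum, K = d^(1/m) and B = sqrt(K/2). With probability pi^m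
   = 1/d all m errors of a column come from N(B,1), so the upper 1/(2d)-quantile x of
   S_j is at least m B, where B -> oo. On the event that some |S_j| exceeds x
   (probability 1 - (1-1/d)^d), the Gaussian tail ratio can only stay above e if the
   second largest |S_l| lies within A/B of the largest. The law of S_j is a mixture of
   N(a, m), hence nearly invariant under translations by multiples of A/B, which spreads
   the mass 1/(2d) beyond x over many intervals of length A/B: each carries o(1/d), and
   a union bound over the columns shows that such near ties have vanishing probability.
   Conditionally on a selected model the same bound is divided by P(M = (j,s)) >= P(s
   S_j >= x) P(|S_l| <= x)^(d-1) >= e^(-1)/(2d), while P(M = (j,s)) <= 1/(2d) by
   symmetry, which gives the conditional probability 1/e. *)

(** * Normal laws *)

Section normal_facts.
Context {R : realType}.
Local Notation leb := (@lebesgue_measure R).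

(** Since [m] need not diverge, no limit theorem for the column sums is available, and their law is
    a mixture of [3^m] overlapping normal components whose density near the quantile is never
    computed. The one regularity used is common to all components and free of their means: the
    standard deviation [sqrt m]. Far in a tail, a normal density is not boundedly comparable with
    its translates, so near invariance costs an additive error governed by [exp (- h^2 / (2 m))],
    with a free parameter [h]. The admissible [h] is of order [m B], and
    [B^2 = exp ((log d) / m) / 2]; the growth of [(log d) / m] makes this error negligible against
    [1/d]. The threshold is an exact quantile, which exists because normal mixtures have no atoms.
    Each of the [2 d] pairs of a column and a sign then exceeds it with probability exactly
    [1/(2d)], so a bound [e' / (2d)] per pair sums to [e']. The uniform limit is refuted at one
    point: if the statistic vanishes on events of probability at least [p = 1/e], its distribution
    function at [p / 2] cannot tend to [p / 2]. *)

Definition translation (t : R) : measurableTypeR R -> measurableTypeR R := fun x => x + t.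

Lemma measurable_translation (t : R) : measurable_fun setT (translation t).
Proof. exact: measurable_funD. Qed.

HB.instance Definition _ t := isMeasurableFun.Build _ _ _ _ (translation t) (measurable_translation t).

Lemma ge0_integral_translation (t : R) (D : set R) (f : R -> \bar R) :
  measurable D -> measurable_fun [set: R] f -> (forall x, 0 <= f x)%E ->
  (\int[leb]_(x in D) f x = \int[leb]_(x in translation t @^-1` D) f (x + t)%R)%E.
Proof.
move=> mD mf f0.
transitivity (\int[pushforward leb (translation t)]_(x in D) f x)%E; last first.
  rewrite ge0_integral_pushforward//; exact: measurable_funTS.
apply: eq_measure_integral => A mA _.
apply: lebesgue_measure_unique => // _ [[a b]] _ <-.
have E : translation t @^-1` `]a, b]%classic = `]a - t, b - t]%classic.
  by apply/seteqP; split => x; rewrite /translation /= !in_itv/= ltrBlDr lerBrDr.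
transitivity (leb `]a - t, b - t]%classic); last by rewrite -E.
rewrite !lebesgue_measure_itv/= !lte_fin ltrD2r.
by case: ifP => // _; rewrite -!EFinB; congr EFin; ring.
Qed.

Lemma ge0_integral_reflection (D : set R) (f : R -> \bar R) :
  measurable D -> measurable_fun [set: R] f -> (forall x, 0 <= f x)%E ->
  (\int[leb]_(x in D) f x = \int[leb]_(x in -%R @^-1` D) f (- x)%R)%E.
Proof.
move=> mD mf f0.
transitivity (\int[pushforward leb (-%R : _ -> measurableTypeR R)]_(x in D) f x)%E.
  apply: eq_measure_integral => A mA _; exact/esym/lebesgue_measureN.
rewrite ge0_integral_pushforward//; exact: measurable_funTS.
Qed.

Lemma normal_pdfD (a s t x : R) : s != 0 ->
  normal_pdf (a + t) s (x + t) = normal_pdf a s x.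
Proof. by move=> s0; rewrite !normal_pdfE//= /normal_fun opprD addrACA subrr addr0. Qed.

Lemma normal_pdfN (a s x : R) : s != 0 -> normal_pdf (- a) s (- x) = normal_pdf a s x.
Proof. by move=> s0; rewrite !normal_pdfE//= /normal_fun -opprD sqrrN. Qed.

Lemma measurable_EFin_normal_pdf (a s : R) : measurable_fun setT (fun x => (normal_pdf a s x)%:E).
Proof. by apply/measurable_EFinP; exact: measurable_normal_pdf. Qed.

Lemma EFin_normal_pdf_ge0 (a s x : R) : (0 <= (normal_pdf a s x)%:E)%E.
Proof. by rewrite lee_fin normal_pdf_ge0. Qed.

Lemma normal_probD (a s t : R) (A : set R) : s != 0 -> measurable A ->
  normal_prob (a + t) s A = normal_prob a s (translation t @^-1` A).
Proof.
move=> s0 mA.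
have := ge0_integral_translation t mA (measurable_EFin_normal_pdf (a + t) s)
  (EFin_normal_pdf_ge0 (a + t) s).
rewrite -/(normal_prob _ _ _) => ->; apply: eq_integral => x _.
by rewrite normal_pdfD.
Qed.

Lemma normal_probN (a s : R) (A : set R) : s != 0 -> measurable A ->
  normal_prob (- a) s A = normal_prob a s (-%R @^-1` A).
Proof.
move=> s0 mA.
have := ge0_integral_reflection mA (measurable_EFin_normal_pdf (- a) s)
  (EFin_normal_pdf_ge0 (- a) s).
rewrite -/(normal_prob _ _ _) => ->; apply: eq_integral => x _.
by rewrite normal_pdfN.
Qed.

End normal_facts.

(** * Convolution, shifts and tails of normal laws *)

Section normal_conv.
Context {R : realType}.
Local Notation leb := (@lebesgue_measure R).

(** Change of variables yields the abstract Radon-Nikodym derivative; it equals [normal_pdf] almost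
    everywhere because both have the same integral over every measurable set. *)
Lemma integral_normal_prob (a s : R) (f : R -> \bar R) :
  measurable_fun setT f -> (forall x, 0 <= f x)%E ->
  (\int[normal_prob a s]_x f x = \int[leb]_x (f x * (normal_pdf a s x)%:E))%E.
Proof.
move=> mf f0.
have nm : normal_prob a s `<< leb by exact: normal_prob_dominates.
rewrite -(Radon_Nikodym_SigmaFinite.change_of_variables nm)//.
have intg := @Radon_Nikodym_SigmaFinite.f_integrable _ _ _ (normal_prob a s) leb nm.
have mg := measurable_int _ intg.
have g0 := Radon_Nikodym_SigmaFinite.f_ge0 nm.
have mp := measurable_EFin_normal_pdf a s.
apply: ge0_ae_eq_integral => //.
- exact: emeasurable_funM.
- exact: emeasurable_funM.
- by move=> x _; rewrite mule_ge0.
- by move=> x _; rewrite mule_ge0// EFin_normal_pdf_ge0.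
- apply: ae_eqe_mul2l; apply: integral_ae_eq => //.
  by move=> E _ mE; rewrite -Radon_Nikodym_SigmaFinite.f_integral.
Qed.

Lemma normal_peakE (s : R) : 0 < s -> normal_peak s = (s * Num.sqrt (pi *+ 2))^-1.
Proof.
move=> s0; rewrite /normal_peak -mulrnAr sqrtrM ?sqr_ge0//.
by rewrite sqrtr_sqr ger0_norm// ltW.
Qed.

(** Completing the square in [y]. The second factor is the conditional density of the summand [y]
    given the sum [x], so it integrates to 1 in [y]. *)
Lemma normal_pdfM (a b s t x y : R) : 0 < s -> 0 < t ->
  let r := Num.sqrt (s ^+ 2 + t ^+ 2) in
  normal_pdf a s (x - y) * normal_pdf b t y =
  normal_pdf (a + b) r x *
    normal_pdf ((t ^+ 2 * (x - a) + s ^+ 2 * b) / r ^+ 2) (s * t / r) y.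
Proof.
move=> s0 t0 r.
have r2 : r ^+ 2 = s ^+ 2 + t ^+ 2 by rewrite sqr_sqrtr// addr_ge0 ?sqr_ge0.
have r0 : 0 < r by rewrite sqrtr_gt0 addr_gt0 ?exprn_gt0.
have q0 : 0 < s * t / r by rewrite divr_gt0// mulr_gt0.
rewrite !normal_pdfE ?gt_eqF//= !normal_peakE// mulrACA [RHS]mulrACA; congr (_ * _).
  rewrite -!invfM; congr (_^-1); rewrite mulrACA [RHS]mulrACA; congr (_ * _).
  by rewrite mulrC mulrCA divff ?mulr1 ?gt_eqF// mulrC.
rewrite /normal_fun -!expRD; congr expR.
have -> : (s * t / r) ^+ 2 = s ^+ 2 * t ^+ 2 / (s ^+ 2 + t ^+ 2).
  by rewrite !exprMn exprVn r2.
rewrite r2; field.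
by rewrite !gt_eqF// addr_gt0 ?exprn_gt0// !mulr_gt0 ?exprn_gt0.
Qed.

(** Tonelli moves the integration over the summand [y] inside, where [normal_pdfM] splits off a
    density in [y] of total mass 1. The left side is the form in which the law of a sum arises from
    [independent_pair_law]. *)
Lemma normal_prob_convolution (a b s t : R) (A : set R) :
  0 < s -> 0 < t -> measurable A ->
  (\int[normal_prob b t]_y normal_prob a s (translation y @^-1` A) =
   normal_prob (a + b) (Num.sqrt (s ^+ 2 + t ^+ 2)) A)%E.
Proof.
move=> s0 t0 mA.
pose F (z : R * R) := (normal_pdf a s (z.1 - z.2) * normal_pdf b t z.2 * \1_A z.1)%:E.
have F0 z : (0 <= F z)%E by rewrite lee_fin !mulr_ge0 ?normal_pdf_ge0.
have mF : measurable_fun setT F.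
  apply/measurable_EFinP; apply: measurable_funM; last first.
    by apply: measurableT_comp => //; exact: measurable_indic.
  apply: measurable_funM.
    apply: measurableT_comp; first exact: measurable_normal_pdf.
    exact: measurable_funB.
  by apply: measurableT_comp => //; exact: measurable_normal_pdf.
have E y : normal_prob a s (translation y @^-1` A) =
    (\int[leb]_(x in A) (normal_pdf a s (x - y))%:E)%E.
  rewrite -normal_probD; [|by rewrite gt_eqF|by []].
  rewrite /normal_prob; apply: eq_integral => x _.
  by rewrite -(normal_pdfD a y (x - y)) ?gt_eqF// subrK.
have m1 (y : R) : measurable_fun setT (fun x : R => (normal_pdf a s (x - y))%:E).
  apply/measurable_EFinP; apply: measurableT_comp; first exact: measurable_normal_pdf.
  exact: measurable_funB.
have E2 y : (normal_prob a s (translation y @^-1` A) * (normal_pdf b t y)%:E =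
    \int[leb]_x F (x, y))%E.
  rewrite E -ge0_integralZr//; last 3 first.
  - by apply: measurable_funTS; exact: m1.
  - by move=> x _; exact: EFin_normal_pdf_ge0.
  - exact: EFin_normal_pdf_ge0.
  rewrite integral_mkcond; apply: eq_integral => x _; rewrite patchE /F/= indicE.
  by case: ifP => _; rewrite ?mulr1 ?mulr0 ?EFinM.
have mG : measurable_fun setT (fun y => normal_prob a s (translation y @^-1` A)).
  pose G (z : R * R) := (normal_pdf a s (z.1 - z.2) * \1_A z.1)%:E.
  have -> : (fun y => normal_prob a s (translation y @^-1` A)) =
      (fun y => \int[leb]_x G (x, y))%E.
    apply/funext => y; rewrite E integral_mkcond; apply: eq_integral => x _.
    by rewrite patchE /G/= indicE; case: ifP => _; rewrite ?mulr1 ?mulr0.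
  apply: (@measurable_fun_fubini_tonelli_G _ _ _ _ R leb G); last first.
    by move=> z; rewrite /G lee_fin mulr_ge0 ?normal_pdf_ge0.
  apply/measurable_EFinP; apply: measurable_funM; last first.
    by apply: measurableT_comp => //; exact: measurable_indic.
  apply: measurableT_comp; first exact: measurable_normal_pdf.
  exact: measurable_funB.
rewrite integral_normal_prob//.
under eq_integral do rewrite E2.
transitivity (\int[leb]_x \int[leb]_y F (x, y))%E.
  by apply/esym; exact: (@fubini_tonelli _ _ _ _ R leb leb F).
rewrite [RHS]integral_mkcond; apply: eq_integral => x _.
set r := Num.sqrt _.
have r0 : 0 < r by rewrite sqrtr_gt0 addr_gt0 ?exprn_gt0.
under eq_integral.
  move=> y _; rewrite /F/= normal_pdfM// -/r mulrAC EFinM; over.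
rewrite /= ge0_integralZl//; last 3 first.
- exact: measurable_EFin_normal_pdf.
- by move=> y _; exact: EFin_normal_pdf_ge0.
- by rewrite lee_fin mulr_ge0 ?normal_pdf_ge0.
rewrite integral_normal_pdf mule1 patchE indicE.
by case: ifP => _; rewrite ?mulr1 ?mulr0.
Qed.

Lemma normal_prob_set1 (a s x : R) : normal_prob a s [set x] = 0%E.
Proof. exact: integral_set1. Qed.

(** The reflection about [a], composed of [x -> -x] and a translation by [-2a], exchanges the two
    closed half-lines at [a], and these cover the line. *)
Lemma normal_prob_ge_mean (a s : R) : s != 0 -> ((2^-1)%:E <= normal_prob a s `[a, +oo[)%E.
Proof.
move=> s0.
have E : normal_prob a s `]-oo, a] = normal_prob a s `[a, +oo[.
  have mB : measurable (`]-oo, (- a)%R]%classic : set R) by [].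
  have := normal_probN a s0 mB.
  have -> : -%R @^-1` `]-oo, (- a)%R] = `[a, +oo[%classic :> set R.
    by apply/seteqP; split => x; rewrite /= !in_itv/= andbT lerN2.
  move=> <-; have -> : - a = a + (- a *+ 2) by ring.
  rewrite normal_probD//; congr (normal_prob a s _).
  by apply/seteqP; split => x; rewrite /translation /= !in_itv/= lerD2r.
have : (normal_prob a s `]-oo, a] + normal_prob a s `[a, +oo[ >= 1)%E.
  rewrite -(@probability_setT _ _ _ (normal_prob a s)).
  have -> : [set: R] = `]-oo, a] `|` `[a, +oo[.
    apply/seteqP; split => x//= _; rewrite !in_itv/= andbT.
    by case: (leP x a) => h; [left|right; exact: ltW].
  exact: measureU2.
rewrite E.
have fn : normal_prob a s `[a, +oo[ \is a fin_num by exact: fin_num_measure.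
rewrite -(fineK fn) -EFinD !lee_fin; lra.
Qed.

(* For [y - a <= h] the ratio of the two densities is controlled; for [y - a > h]
   the density at [y] is itself below the second summand, the peak being at most 1. *)
Lemma normal_pdf_shift_le (a s h t y : R) : 1 <= s -> 0 <= t -> 0 <= h ->
  normal_pdf a s y <= expR ((h * t *+ 2 + t ^+ 2) / (s ^+ 2 *+ 2)) * normal_pdf a s (y + t)
    + expR (- h ^+ 2 / (s ^+ 2 *+ 2)).
Proof.
move=> s1 t0 h0; have s0 : 0 < s by exact: lt_le_trans s1.
have s2 : 0 < s ^+ 2 *+ 2 by rewrite mulrn_wgt0 ?exprn_gt0.
rewrite !normal_pdfE ?gt_eqF//= /normal_fun.
have [yh|hy] := leP (y - a) h.
  apply: ler_wpDr; first exact: expR_ge0.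
  rewrite mulrCA ler_wpM2l ?normal_peak_ge0// -expRD ler_expR -mulrDl.
  rewrite ler_pM2r ?invr_gt0//.
  have : (y - a) * t <= h * t by rewrite ler_wpM2r.
  move=> H; rewrite -subr_ge0 [X in 0 <= X](_ : _ = (h * t - (y - a) * t) *+ 2).
    by rewrite mulrn_wge0// subr_ge0.
  ring.
apply: ler_wpDl; first by rewrite mulr_ge0 ?expR_ge0// mulr_ge0 ?normal_peak_ge0 ?expR_ge0.
rewrite -[leRHS]mul1r ler_pM ?normal_peak_ge0 ?expR_ge0//.
  have pi0 : 0 < pi *+ 2 :> R by have := pi_gt0 R; lra.
  rewrite normal_peakE// invf_le1 ?mulr_gt0 ?sqrtr_gt0//.
  rewrite -[leLHS]mul1r ler_pM// -[leLHS]sqrtr1 ler_wsqrtr//.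
  by have := pi_ge2 R; lra.
rewrite ler_expR ler_pM2r ?invr_gt0// lerN2 ler_sqr ?nnegrE//; lra.
Qed.

(** The pointwise bound integrated over an interval of length [d]. A larger [h] reduces the additive
    error and raises the multiplicative cost of the shift. *)
Lemma normal_prob_shift_le (a s h t d x : R) : 1 <= s -> 0 <= t -> 0 <= h -> 0 <= d ->
  (normal_prob a s `](x - d)%R, x] <=
   (expR ((h * t *+ 2 + t ^+ 2) / (s ^+ 2 *+ 2)))%:E * normal_prob a s `](x + t - d)%R, (x + t)%R]
   + (d * expR (- h ^+ 2 / (s ^+ 2 *+ 2)))%:E)%E.
Proof.
move=> s1 t0 h0 d0; have s0 : s != 0 by rewrite gt_eqF// (lt_le_trans _ s1).
set c := expR _; set r := expR (_ / _).
have c0 : 0 <= c by exact: expR_ge0.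
have r0 : 0 <= r by exact: expR_ge0.
have -> : normal_prob a s `](x + t - d)%R, (x + t)%R] =
    (\int[leb]_(y in `](x - d)%R, x]) (normal_pdf a s (y + t))%:E)%E.
  have := ge0_integral_translation t (measurable_itv `](x + t - d)%R, (x + t)%R])
    (measurable_EFin_normal_pdf a s) (EFin_normal_pdf_ge0 a s).
  rewrite -/(normal_prob _ _ _) => ->; congr integral.
  apply/seteqP; split => y; rewrite /translation/= !in_itv/= => /andP[y1 y2];
    apply/andP; split; lra.
have m1 : measurable_fun setT (fun y : R => (normal_pdf a s (y + t))%:E).
  apply/measurable_EFinP; apply: measurableT_comp; first exact: measurable_normal_pdf.
  exact: measurable_funD.
rewrite -ge0_integralZl//; last 2 first.
- exact: measurable_funTS.
- by move=> y _; exact: EFin_normal_pdf_ge0.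
have -> : (d * r)%:E = (\int[leb]_(y in `](x - d)%R, x]) r%:E)%E.
  rewrite integral_cst//= lebesgue_measure_itv/= lte_fin.
  rewrite ltrBlDr ltrDl; case: ltP => [_|d0'].
    by rewrite -EFinD -EFinM opprB addrCA subrr addr0 mulrC.
  by rewrite (_ : d = 0) ?mul0r ?mule0//; apply/eqP; rewrite eq_le d0 d0'.
rewrite -ge0_integralD//; last 2 first.
- by move=> y _; rewrite mule_ge0// EFin_normal_pdf_ge0.
- by apply: measurable_funeM; exact: measurable_funTS.
apply: ge0_le_integral => //.
- by move=> y _; exact: EFin_normal_pdf_ge0.
- by apply: measurable_funTS; exact: measurable_EFin_normal_pdf.
- apply: emeasurable_funD => //.
  by apply: measurable_funeM; exact: measurable_funTS.
- by move=> y _; rewrite lee_fin normal_pdf_shift_le.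
Qed.

Lemma one_sub_Phi (x : R) : 1 - Phi x = fine (normal_prob 0 1 `]x, +oo[).
Proof.
rewrite /Phi; have -> : `]x, +oo[%classic = ~` [set` `]-oo, x]] by rewrite setCitvl.
rewrite probability_setC//.
by rewrite -[in RHS](fineK (fin_num_measure (normal_prob (0:R) 1) _ (measurable_itv `]-oo, x]))).
Qed.

Lemma one_sub_Phi_ge0 (x : R) : 0 <= 1 - Phi x.
Proof. by rewrite one_sub_Phi fine_ge0. Qed.

(** Shifting the tail at [v] back by [t = v - u] multiplies the density at [y > u] by
    [exp (- (2 y t + t^2) / 2)], which is at most its value at [y = u], namely
    [exp (- (v^2 - u^2) / 2)]. *)
Lemma one_sub_Phi_le (u v : R) : 0 <= u -> u <= v ->
  1 - Phi v <= expR (- (v ^+ 2 - u ^+ 2) / 2) * (1 - Phi u).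
Proof.
move=> u0 uv; rewrite !one_sub_Phi -lee_fin EFinM !fineK ?fin_num_measure//.
pose t := v - u.
have t0 : 0 <= t by rewrite subr_ge0.
have -> : normal_prob 0 1 `]v, +oo[ = (\int[leb]_(y in `]u, +oo[) (normal_pdf 0 1 (y + t))%:E)%E.
  have := ge0_integral_translation t (measurable_itv `]v, +oo[)
    (measurable_EFin_normal_pdf 0 1) (EFin_normal_pdf_ge0 0 1).
  rewrite -/(normal_prob _ _ _) => ->; congr integral.
  apply/seteqP; split => y; rewrite /translation/= !in_itv/= !andbT /t; lra.
have m1 : measurable_fun setT (fun y : R => (normal_pdf 0 1 (y + t))%:E).
  apply/measurable_EFinP; apply: measurableT_comp; first exact: measurable_normal_pdf.
  exact: measurable_funD.
rewrite /normal_prob -ge0_integralZl//; last 2 first.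
- by apply: measurable_funTS; exact: measurable_EFin_normal_pdf.
- by move=> y _; exact: EFin_normal_pdf_ge0.
apply: ge0_le_integral => //.
- by move=> y _; exact: EFin_normal_pdf_ge0.
- exact: measurable_funTS.
- by apply: measurable_funeM; apply: measurable_funTS; exact: measurable_EFin_normal_pdf.
- move=> y; rewrite /= in_itv/= andbT => uy.
  rewrite lee_fin !normal_pdfE ?oner_neq0//= mulrCA ler_wpM2l ?normal_peak_ge0//.
  rewrite /normal_fun -expRD ler_expR !subr0 expr1n.
  rewrite -subr_ge0 [X in 0 <= X](_ : _ = t * (y - u)); last by rewrite /t; field.
  by rewrite mulr_ge0// subr_ge0 ltW.
Qed.

End normal_conv.

(** * Grouping independent variables *)

Section independence.
Context d (T : measurableType d) (R : realType) (P : probability T R).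

(** The pi-systems are replaced by their sigma-algebras one index at a time. With the other events
    fixed and [D] their intersection, [A -> P (A & D)] and [A -> c * P A] are finite measures that
    agree on the pi-system [C k], hence on what it generates. *)
Lemma independence_generated (K : finType) (C : K -> set (set T)) :
  (forall k, C k `<=` measurable) -> (forall k, setI_closed (C k)) ->
  (forall k, C k setT) ->
  (forall E : K -> set T, (forall k, C k (E k)) ->
    P (\bigcap_k E k) = (\prod_k P (E k))%E) ->
  forall E : K -> set T, (forall k, <<s C k >> (E k)) ->
    P (\bigcap_k E k) = (\prod_k P (E k))%E.
Proof.
move=> Cm CI CT Cind.
have sCm k A : <<s C k >> A -> measurable A.
  by apply: smallest_sub; [exact: sigma_algebra_measurable|exact: Cm].
(* [s] lists the indices already passed from [C k] to the sigma-algebra it generates. *)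
suff main (s : seq K) (E : K -> set T) : (forall k, k \in s -> <<s C k >> (E k)) ->
    (forall k, k \notin s -> C k (E k)) -> P (\bigcap_k E k) = (\prod_k P (E k))%E.
  by move=> E CE; apply: (main (enum K)) => k; [move=> _; exact: CE|rewrite mem_enum].
elim: s E => [|k s IH] E Es Ens; first by apply: Cind => k; exact: Ens.
have mE l : measurable (E l).
  have [ls|ls] := boolP (l \in k :: s); first by apply: (sCm l); exact: Es.
  by apply: (Cm l); exact: Ens.
pose D := \bigcap_(l in [set l | l != k]) E l.
have mD : measurable D by apply: fin_bigcap_measurable => //; exact: finite_finset.
pose c := fine (\prod_(l | l != k) P (E l))%E.
have cE : (\prod_(l | l != k) P (E l) = c%:E)%E.
  by rewrite fineK// prode_fin_num// => l _; exact: fin_num_measure.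
have c0 : 0 <= c by apply: fine_ge0; apply: prode_ge0.
pose m2 := mscale (NngNum c0) P.
pose m1 := mrestr P mD.
have splitE (A : set T) : A `&` D = \bigcap_l (if l == k then A else E l).
  apply/seteqP; split => [x [Ax Dx] l _|x H].
    by case: eqVneq => // lk; exact: Dx.
  split; first by have := H k I; rewrite eqxx.
  by move=> l /= lk; have := H l I; rewrite (negbTE lk).
have main A : <<s C k >> A -> m1 A = m2 A.
  apply: (g_sigma_algebra_measure_unique (C k) (Cm k) (fun=> setT)) => //.
  - by rewrite bigcup_const.
  - move=> B CB; transitivity (P (B `&` D)) => //; rewrite splitE IH.
    + transitivity (c%:E * P B)%E => //.
      rewrite (bigD1 k)//= eqxx muleC; congr (_ * _)%E.
      by rewrite -cE; apply: eq_bigr => l /negbTE ->.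
    + move=> l ls; case: eqVneq => [->|lk]; first exact: sub_sigma_algebra.
      by apply: Es; rewrite inE ls orbT.
    + move=> l ls; case: eqVneq => [->//|lk].
      by apply: Ens; rewrite inE (negbTE lk).
  - move=> _; apply: (@le_lt_trans _ _ 1%E); last exact: ltry.
    by apply: probability_le1; exact: measurableI.
have := main (E k) (Es k (mem_head _ _)).
move=> H; rewrite (bigD1 k)//= muleC cE; transitivity (P (E k `&` D)) => //.
rewrite splitE; congr (P _).
by apply: eq_bigcapr => l _; case: eqVneq => // ->.
Qed.

(** [kappa] assigns each variable to a group. These are the rectangles in the variables of group
    [k]: a pi-system generating the sigma-algebra of that group. *)
Definition grouped_events (J K : finType) (kappa : J -> K) (X : J -> {RV P >-> R}) (k : K)
  : set (set T) :=
  [set F | exists2 A : J -> set R, forall i, measurable (A i) &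
     F = \bigcap_(i in [set i | kappa i = k]) (X i @^-1` A i)].

Lemma measurable_grouped (J K : finType) (kappa : J -> K) (X : J -> {RV P >-> R}) i :
  measurable_fun setT (X i : g_sigma_algebraType (grouped_events kappa X (kappa i)) -> R).
Proof.
move=> _ B mB; rewrite setTI; apply: sub_sigma_algebra.
exists (fun l => if l == i then B else setT) => [l|]; first by case: ifP.
apply/seteqP; split => [x Bx l /= _|x /= H]; first by case: eqVneq => [->|].
by have := H i erefl; rewrite /= eqxx.
Qed.

Lemma independence_grouped (J K : finType) (kappa : J -> K) (X : J -> {RV P >-> R})
    (f : K -> T -> R) :
  mutually_independent X ->
  (forall k, measurable_fun setT
     (f k : g_sigma_algebraType (grouped_events kappa X k) -> R)) ->
  forall A : K -> set R, (forall k, measurable (A k)) ->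
    P (\bigcap_k (f k @^-1` A k)) = (\prod_k P (f k @^-1` A k))%E.
Proof.
move=> Xind mf A mA.
apply: (@independence_generated K (grouped_events kappa X)).
- move=> k _ [B mB ->]; apply: fin_bigcap_measurable => [|i _].
    exact: finite_finset.
  exact: measurable_funPTI.
- move=> k _ _ [B1 mB1 ->] [B2 mB2 ->].
  exists (fun i => B1 i `&` B2 i) => [i|]; first exact: measurableI.
  by rewrite -bigcapI; apply: eq_bigcapr => i _; rewrite preimage_setI.
- move=> k; exists (fun=> setT) => //.
  by apply/esym; rewrite bigcapT// => i _; rewrite preimage_setT.
(* Each variable lies in one group only, so the families [B k] glue to the single family
   [B (kappa i) i]. Independence is applied to it twice: over all indices, and within each group. *)
- move=> E CE; pose B k := sval (cid2 (CE k)).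
  have mB k i : measurable (B k i) by rewrite /B; case: cid2.
  have EB k : E k = \bigcap_(i in [set i | kappa i = k]) (X i @^-1` B k i).
    by rewrite /B; case: cid2.
  have Bk k i : kappa i = k -> B k i = B (kappa i) i by move=> ->.
  have := Xind [set: J]%SET (fun i => B (kappa i) i) (fun i => mB _ _).
  have -> : \bigcap_(i in [set` [set: J]%SET]) X i @^-1` B (kappa i) i = \bigcap_k E k.
    apply/seteqP; split => [x H k _|x H i _].
      by rewrite EB => i /= ik; rewrite Bk//; apply: H; rewrite /= inE.
    by have := H (kappa i) I; rewrite EB; exact.
  move=> ->; rewrite (eq_bigl predT); last by move=> i; rewrite inE.
  rewrite (partition_big kappa predT)//=; apply: eq_bigr => k _.
  have := Xind [set i | kappa i == k]%SET (fun i => B (kappa i) i) (fun i => mB _ _).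
  move=> HX; transitivity (\prod_(i in [set i | kappa i == k]%SET) P (X i @^-1` B (kappa i) i))%E.
    by apply: eq_bigl => i; rewrite inE.
  rewrite -HX EB; congr (P _).
  apply/seteqP; split => [x H i /= ik|x H i].
    by rewrite Bk//; apply: H; rewrite /= inE ik.
  by rewrite /= inE => /eqP ik; rewrite -(Bk k)//; exact: H.
- move=> k; have := mf k measurableT (A k) (mA k); rewrite setTI; exact.
Qed.

End independence.

(** * Mixtures of normal laws *)

Section pair_law.
Context d d1 d2 (T : measurableType d) (T1 : measurableType d1) (T2 : measurableType d2)
  (R : realType) (P : probability T R).
Variables (X : {mfun T >-> T1}) (Y : {mfun T >-> T2}).
Hypothesis XY : forall A B, measurable A -> measurable B ->
  P (X @^-1` A `&` Y @^-1` B) = (P (X @^-1` A) * P (Y @^-1` B))%E.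

(** The joint law agrees with the product measure on rectangles, hence everywhere, and the product
    measure is by construction the integral over sections. *)
Lemma independent_pair_law (C : set (T1 * T2)) : measurable C ->
  P ((fun w => (X w, Y w)) @^-1` C) =
  (\int[distribution P X]_x P (Y @^-1` (xsection C x)))%E.
Proof.
move=> mC.
have mXY : measurable_fun setT (fun w => (X w, Y w)) by exact/measurable_fun_pair.
pose XY' : {mfun T >-> (T1 * T2)%type} := HB.pack (fun w => (X w, Y w))
  (isMeasurableFun.Build _ _ _ _ _ mXY).
have := @product_measure_unique _ _ _ _ R (distribution P X) (distribution P Y)
  (distribution P XY').
by move=> H; transitivity (distribution P XY' C) => //; rewrite -H.
Qed.

End pair_law.

Section normal_mixture.
Context {R : realType}.
Implicit Types (s : seq (R * R)) (sigma : R).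

(* A list of pairs (weight, mean) stands for the mixture of normal laws with these
   weights and means and common standard deviation [sigma]. *)
Definition mixture s sigma (A : set R) : \bar R :=
  (\sum_(w <- s) w.1%:E * normal_prob w.2 sigma A)%E.

(** Integration requires a measure, whereas [mixture] is a bare set function. The absolute value
    supplies the nonnegative scalar that [mscale] asks for; for nonnegative weights both have the
    same values. *)
Fixpoint mixture_measure s sigma : {measure set (measurableTypeR R) -> \bar R} :=
  if s is w :: s' then
    measure_add (mscale (NngNum (normr_ge0 w.1)) (normal_prob w.2 sigma))
      (mixture_measure s' sigma)
  else mzero.

Lemma integral_mixture s sigma (nu : {measure set (measurableTypeR R) -> \bar R})
    (f : R -> \bar R) :
  (forall w, w \in s -> 0 <= w.1) ->
  (forall A, measurable A -> nu A = mixture s sigma A) ->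
  measurable_fun setT f -> (forall x, 0 <= f x)%E ->
  (\int[nu]_x f x = \sum_(w <- s) w.1%:E * \int[normal_prob w.2 sigma]_x f x)%E.
Proof.
move=> s0 nuE mf f0.
transitivity (\int[mixture_measure s sigma]_x f x)%E.
  apply: eq_measure_integral => A mA _; rewrite nuE//.
  elim: s s0 {nuE} => [|w s IH] s0; first by rewrite /mixture big_nil.
  rewrite [RHS]measure_addE /mixture big_cons -/(mixture _ _ _); congr (_ + _)%E.
    transitivity (`|w.1|%:E * normal_prob w.2 sigma A)%E => //.
    by rewrite ger0_norm// s0// mem_head.
  by apply: IH => v vs; apply: s0; rewrite inE vs orbT.
elim: s s0 {nuE} => [|w s IH] s0 /=; first by rewrite big_nil integral_measure_zero.
rewrite big_cons ge0_integral_measure_add//; congr (_ + _)%E; last first.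
  by apply: IH => v vs; apply: s0; rewrite inE vs orbT.
by rewrite ge0_integral_mscale//= ger0_norm// s0// mem_head.
Qed.

Definition convolution s s' : seq (R * R) :=
  [seq (w.1 * v.1, w.2 + v.2) | w <- s, v <- s'].

Lemma convolution_ge0 s s' : (forall w, w \in s -> 0 <= w.1) ->
  (forall w, w \in s' -> 0 <= w.1) -> forall w, w \in convolution s s' -> 0 <= w.1.
Proof. move=> s0 s0' w /allpairsP[[u v] /= [us vs ->]]; apply: mulr_ge0; [exact: s0|exact: s0']. Qed.

(** Conditioning on [X] turns the law of the sum into an integral of translates of the law of [Y];
    expanding both mixtures leaves one normal convolution per pair of components. *)
Lemma mixture_convolution d (T : measurableType d) (P : probability T R)
    (X Y : {RV P >-> R}) s s' a b (A : set R) :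
  (forall A B : set R, measurable A -> measurable B ->
    P (X @^-1` A `&` Y @^-1` B) = (P (X @^-1` A) * P (Y @^-1` B))%E) ->
  (forall w, w \in s -> 0 <= w.1) -> (forall w, w \in s' -> 0 <= w.1) ->
  0 < a -> 0 < b ->
  (forall A, measurable A -> P (X @^-1` A) = mixture s a A) ->
  (forall A, measurable A -> P (Y @^-1` A) = mixture s' b A) ->
  measurable A ->
  P ((fun w => X w + Y w) @^-1` A) =
  mixture (convolution s s') (Num.sqrt (a ^+ 2 + b ^+ 2)) A.
Proof.
move=> XY s0 s0' a0 b0 XE YE mA.
pose C : set (R * R) := (fun z => z.1 + z.2) @^-1` A.
have mC : measurable C.
  by rewrite -[C]setTI; apply: (measurable_funD measurable_fst measurable_snd).
have xC x : xsection C x = translation x @^-1` A.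
  by apply/seteqP; split => y; rewrite /xsection/= inE /C /translation/= addrC.
transitivity (P ((fun w => (X w, Y w)) @^-1` C)) => //.
pose X' : {mfun T >-> measurableTypeR R} := HB.pack (X : T -> measurableTypeR R)
  (isMeasurableFun.Build _ _ T (measurableTypeR R) X (measurable_funPT X)).
rewrite (@independent_pair_law _ _ _ _ (measurableTypeR R) R _ P X' Y)//.
have mN v : measurable_fun setT (fun x : R => normal_prob v b (translation x @^-1` A)).
  have := measurable_fun_xsection (normal_prob v b) mC.
  by congr measurable_fun; apply/funext => x /=; rewrite xC.
(* The absolute values make the summands nonnegative for every [v], as the exchange of sum and
   integral demands, and not only for members of [s']. *)
have YxC x : P (Y @^-1` xsection C x) =
    (\sum_(v <- s') `|v.1|%:E * normal_prob v.2 b (translation x @^-1` A))%E.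
  rewrite YE; last exact: measurable_xsection.
  rewrite /mixture !big_seq; apply: eq_bigr => v vs'; rewrite xC.
  by rewrite ger0_norm// s0'.
rewrite (@integral_mixture s a (distribution P X') _ s0 XE)//; last first.
  exact: (measurable_fun_xsection (distribution P Y)).
rewrite /mixture /convolution big_allpairs_dep/=.
rewrite [in LHS]big_seq_cond [in RHS]big_seq_cond; apply: eq_bigr => w; rewrite andbT => ws.
under eq_integral do rewrite YxC.
rewrite ge0_integral_sum//; last 2 first.
- by move=> v; apply: measurable_funeM; exact: mN.
- by move=> v x _; rewrite mule_ge0.
rewrite ge0_sume_distrr; last by move=> v _; apply: integral_ge0 => x _; rewrite mule_ge0.
rewrite [in LHS]big_seq_cond [in RHS]big_seq_cond; apply: eq_bigr => v; rewrite andbT => vs'.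
rewrite ge0_integralZl//; last exact: mN.
have -> := normal_prob_convolution v.2 w.2 b0 a0 mA.
rewrite muleA -EFinM.
rewrite (ger0_norm (s0' v vs')).
by rewrite (addrC v.2) (addrC (b ^+ 2)).
Qed.

End normal_mixture.

Lemma mixture3 (R : realType) (p q r a b c sigma : R) (A : set R) :
  mixture [:: (p, a); (q, b); (r, c)] sigma A =
  (p%:E * normal_prob a sigma A + q%:E * normal_prob b sigma A + r%:E * normal_prob c sigma A)%E.
Proof.
rewrite /mixture.
rewrite !big_cons.
rewrite big_nil.
rewrite [X in (_ + (_ + X))%E]adde0.
by rewrite addeA.
Qed.

(** * The mixtures describing one error and a sum of errors *)

Section noise.
Context (R : realType) (m d : nat).
Hypothesis hpi : 2 * mix_weight R m d <= 1.
Local Notation p := (mix_weight R m d).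
Local Notation B := (mix_shift R m d).

Definition noise : seq (R * R) := [:: (p, - B); (1 - 2 * p, 0); (p, B)].

Lemma error_lawE (A : set R) : error_law m d A = mixture noise 1 A.
Proof.
exact/esym/mixture3.
Qed.

(* [noise_sum k] describes the sum of [k.+1] errors. *)
Fixpoint noise_sum k : seq (R * R) :=
  if k is k'.+1 then convolution (noise_sum k') noise else noise.

Lemma mix_weight_ge0 : 0 <= p. Proof. exact: powR_ge0. Qed.

Lemma noise_ge0 w : w \in noise -> 0 <= w.1.
Proof.
have p0 := mix_weight_ge0.
by rewrite !inE => /or3P[] /eqP -> //=; rewrite subr_ge0.
Qed.

Lemma noise_sum_ge0 k w : w \in noise_sum k -> 0 <= w.1.
Proof.
elim: k w => [|k IH] w; first exact: noise_ge0.
by move=> /(convolution_ge0 IH noise_ge0).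
Qed.

Lemma noise_sum_weight k : \sum_(w <- noise_sum k) w.1 = 1.
Proof.
elim: k => [|k IH]; first by rewrite !big_cons big_nil/=; ring.
rewrite big_allpairs_dep/= -[RHS]IH; apply: eq_bigr => w _.
by rewrite !big_cons big_nil/=; ring.
Qed.

(** The summand [F] is arbitrary so that the induction hypothesis can be applied to the inner sum
    over [noise]. The same statement then gives the symmetry of the law and the vanishing of the
    mean. *)
Lemma noise_sum_sym k (F : R -> R -> \bar R) :
  (\sum_(w <- noise_sum k) F w.1 (- w.2)%R = \sum_(w <- noise_sum k) F w.1 w.2)%E.
Proof.
elim: k F => [|k IH] F.
  rewrite !big_cons !big_nil/= opprK oppr0 !adde0.
  by rewrite addeCA [in RHS]addeCA; congr (_ + _)%E; rewrite addeC.
rewrite !big_allpairs_dep/=.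
rewrite -(IH (fun a b => \sum_(v <- noise) F (a * v.1)%R (b + v.2)%R)%E)/=.
apply: eq_bigr => w _.
rewrite /noise !big_cons !big_nil/= !opprD opprK oppr0 !addr0.
by rewrite addeCA [in RHS]addeCA; congr (_ + _)%E; rewrite addeC.
Qed.

Lemma noise_sum_extreme k :
  (p ^+ k.+1, k.+1%:R * B) \in noise_sum k.
Proof.
have hB : (p, B) \in noise by rewrite !inE eqxx !orbT.
elim: k => [|k IH]; first by rewrite mul1r.
by apply/allpairsP; exists ((p ^+ k.+1, k.+1%:R * B), (p, B));
  split => //=; rewrite -exprSr -[in LHS]natr1 mulrDl mul1r.
Qed.

Lemma mixture_noise_sumN k sigma (A : set R) : sigma != 0 -> measurable A ->
  mixture (noise_sum k) sigma (-%R @^-1` A) = mixture (noise_sum k) sigma A.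
Proof.
move=> s0 mA; rewrite /mixture.
rewrite -(noise_sum_sym k (fun a b => a%:E * normal_prob b sigma A)%E).
by apply: eq_bigr => w _; rewrite normal_probN.
Qed.

Lemma mixture_noise_sum_set1 k sigma x : mixture (noise_sum k) sigma [set x] = 0%E.
Proof. by rewrite /mixture big1// => w _; rewrite normal_prob_set1 mule0. Qed.

(** Only the component with all errors centred at [B] is kept; half of its mass lies above its
    mean. *)
Lemma mixture_noise_sum_ge k sigma : sigma != 0 ->
  ((p ^+ k.+1 / 2)%:E <= mixture (noise_sum k) sigma `[(k.+1%:R * B)%R, +oo[)%E.
Proof.
move=> s0; rewrite /mixture (big_rem _ (noise_sum_extreme k))/=.
have w0 : (0 <= (p ^+ k.+1)%:E)%E by rewrite lee_fin exprn_ge0// mix_weight_ge0.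
apply: (@le_trans _ _ ((p ^+ k.+1)%:E * normal_prob (k.+1%:R * B)%R sigma `[(k.+1%:R * B)%R, +oo[)%E).
  by rewrite EFinM lee_wpmul2l//; exact: normal_prob_ge_mean.
rewrite leeDl// big_seq; apply: sume_ge0 => w /mem_rem /noise_sum_ge0 v0.
by rewrite mule_ge0.
Qed.

(** The constants of the normal bound do not involve the mean, so it averages over the components.
    As the weights sum to 1, the additive error does not grow with their number. *)
Lemma mixture_noise_sum_shift_le k sigma h t e x : 1 <= sigma -> 0 <= t -> 0 <= h -> 0 <= e ->
  (mixture (noise_sum k) sigma `](x - e)%R, x] <=
   (expR ((h * t *+ 2 + t ^+ 2) / (sigma ^+ 2 *+ 2)))%:E *
     mixture (noise_sum k) sigma `](x + t - e)%R, (x + t)%R]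
   + (e * expR (- h ^+ 2 / (sigma ^+ 2 *+ 2)))%:E)%E.
Proof.
move=> s1 t0 h0 e0; set c := expR _; set r := _ * _.
have -> : r%:E = (\sum_(w <- noise_sum k) w.1%:E * r%:E)%E.
  under eq_bigr do rewrite -EFinM.
  by rewrite sumEFin -mulr_suml noise_sum_weight mul1r.
have -> : (c%:E * mixture (noise_sum k) sigma `](x + t - e)%R, (x + t)%R] =
    \sum_(w <- noise_sum k)
      c%:E * (w.1%:E * normal_prob w.2 sigma `](x + t - e)%R, (x + t)%R]))%E.
  rewrite /mixture !big_seq ge0_sume_distrr// => w /noise_sum_ge0 w0.
  by rewrite mule_ge0.
rewrite /mixture -big_split/= !big_seq; apply: lee_sum => w /noise_sum_ge0 w0.
rewrite muleCA -ge0_muleDr; last 2 first.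
- by rewrite mule_ge0// lee_fin expR_ge0.
- by rewrite lee_fin mulr_ge0// expR_ge0.
by apply: lee_wpmul2l; [rewrite lee_fin|exact: normal_prob_shift_le].
Qed.

End noise.

(** * Variance of the errors *)

Section second_moment.
Context {R : realType}.
Local Notation leb := (@lebesgue_measure R).
Let g (x : R) : R := expR (- x ^+ 2 / 2).
(** [G' = (1 - x^2) g], and [G] vanishes at 0 and at infinity, so [x^2 g] and [g] have the same
    integral over the half-line. The integration is split at 1, where [1 - x^2] changes sign, to
    keep every integrand nonnegative; the boundary terms [g 1] cancel. *)
Let G (x : R) : R := x * g x.

Let is_derive_G (x : R) : is_derive x 1 G ((1 - x ^+ 2) * g x).
Proof.
rewrite /G /g; apply: is_derive_eq.
rewrite /GRing.scale/=; move: (expR _) => z; by field.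
Qed.

Let cvg_G : G x @[x --> +oo%R] --> (0 : R).
Proof.
apply: (@squeeze_cvgr _ _ _ _ (fun=> 0) (fun x => 2 / x)).
- near=> x.
  have x0 : 0 < x by near: x; exact: nbhs_pinfty_gt.
  rewrite /G mulr_ge0 ?expR_ge0 ?(ltW x0)//= /g mulNr expRN.
  rewrite ler_pdivlMr// mulrAC ler_pdivrMr ?expR_gt0//.
  by have := expR_ge1Dx (x ^+ 2 / 2); lra.
- exact: cvg_cst.
- rewrite -[X in _ --> X](mulr0 2); apply: cvgM; first exact: cvg_cst.
  apply/gtr0_cvgV0; last exact: cvg_id.
  exact: nbhs_pinfty_gt.
Unshelve. all: by end_near.
Qed.

Let continuous_g : continuous g.
Proof.
move=> x; apply: differentiable_continuous; apply/derivable1_diffP.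
by rewrite /g; apply: ex_derive.
Qed.

Let g0 x : 0 <= g x. Proof. exact: expR_ge0. Qed.

Let continuous_sqrM (f : R -> R) : continuous f -> continuous (fun x => f x * g x).
Proof. by move=> cf x; apply: cvgM; [exact: cf|exact: continuous_g]. Qed.

Let derivable_G x : derivable G x 1. Proof. by have [] := is_derive_G x. Qed.
Let derive_G x : (G^`())%classic x = (1 - x ^+ 2) * g x.
Proof. by rewrite derive1E; have [_ ->] := is_derive_G x. Qed.
Let continuous_G : continuous G.
Proof. by move=> x; apply: differentiable_continuous; apply/derivable1_diffP. Qed.

Let integral_01 : (\int[leb]_(x in `[0%R, 1%R]) ((1 - x ^+ 2) * g x)%:E = (g 1)%:E)%E.
Proof.
rewrite (@continuous_FTC2 _ _ G)//.
- by rewrite /G mul0r mul1r sube0.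
- apply: continuous_subspaceT; apply: continuous_sqrM => x.
  by apply: cvgB; [exact: cvg_cst|exact: exprn_continuous].
- split=> [x _|/=|/=]; first exact: derivable_G.
    by apply: cvg_at_right_filter; exact: continuous_G.
  by apply: cvg_at_left_filter; exact: continuous_G.
Qed.

Let integral_1y : (\int[leb]_(x in `[1%R, +oo[) ((x ^+ 2 - 1) * g x)%:E = (g 1)%:E)%E.
Proof.
rewrite (@ge0_continuous_FTC2y _ _ (- G) _ 0)//.
- by rewrite sub0e -EFinN [(- G) 1]/= opprK /G mul1r.
- move=> x x1; rewrite mulr_ge0// subr_ge0 exprn_ege1//.
- apply: continuous_subspaceT; apply: continuous_sqrM => x.
  by apply: cvgB; [exact: exprn_continuous|exact: cvg_cst].
- by rewrite -oppr0; exact: cvgN.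
- by apply: cvgN; apply: cvg_at_right_filter; exact: continuous_G.
- move=> x _; rewrite derive1N; last exact: derivable_G.
  by rewrite derive_G -mulNr opprB.
Qed.

Let mg : measurable_fun setT g.
Proof. exact: continuous_measurable_fun continuous_g. Qed.

Let mX2g : measurable_fun setT (fun x : R => x ^+ 2 * g x).
Proof. by apply: measurable_funM => //; exact: exprn_measurable. Qed.

Let X2g0 x : 0 <= x ^+ 2 * g x.
Proof. by rewrite mulr_ge0// sqr_ge0. Qed.

Let split01 (f : R -> R) : measurable_fun setT f -> (forall x, 0 <= f x) ->
  (\int[leb]_(x in [set x | (0 <= x)%R]) (f x)%:E =
   \int[leb]_(x in `[0%R, 1%R]) (f x)%:E + \int[leb]_(x in `[1%R, +oo[) (f x)%:E)%E.
Proof.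
move=> mf f0.
have mfe D : measurable_fun D (fun x : R => (f x)%:E) by apply/measurable_EFinP; exact: measurable_funTS.
rewrite -(@integral_itv_obnd_cbnd _ 1%R)//.
rewrite -ge0_integral_setU//=.
- congr integral; apply/seteqP; split => x /=; rewrite !in_itv/= andbT.
    by move=> x0; case: (leP x 1) => x1; [left|right]; rewrite ?x0.
  by move=> [/andP[]//|x1]; rewrite (le_trans _ (ltW x1)).
- exact: mfe.
- by move=> x _; rewrite lee_fin.
- apply/disj_setPS => x /= []; rewrite !in_itv/= andbT => /andP[_].
  by rewrite leNgt => /negP.
Qed.

Let integral_0y : (\int[leb]_(x in [set x | (0 <= x)%R]) (x ^+ 2 * g x)%:E =
  \int[leb]_(x in [set x | (0 <= x)%R]) (g x)%:E)%E.
Proof.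
have mfe (f : R -> R) D : measurable_fun setT f -> measurable_fun D (fun x : R => (f x)%:E).
  by move=> mf; apply/measurable_EFinP; exact: measurable_funTS.
have E1 : (\int[leb]_(x in `[0%R, 1%R]) (x ^+ 2 * g x)%:E + (g 1)%:E =
    \int[leb]_(x in `[0%R, 1%R]) (g x)%:E)%E.
  rewrite -integral_01 -ge0_integralD//.
  - by apply: eq_integral => x _; rewrite -EFinD; congr EFin; ring.
  - by move=> x _; rewrite lee_fin.
  - exact: mfe.
  - move=> x /=; rewrite in_itv/= => /andP[x0 x1].
    by rewrite lee_fin mulr_ge0// subr_ge0 exprn_ile1.
  - by apply: mfe; apply: measurable_funM => //; apply: measurable_funB.
have E2 : (\int[leb]_(x in `[1%R, +oo[) (x ^+ 2 * g x)%:E =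
    (g 1)%:E + \int[leb]_(x in `[1%R, +oo[) (g x)%:E)%E.
  rewrite -integral_1y -ge0_integralD//.
  - by apply: eq_integral => x _; rewrite -EFinD; congr EFin; ring.
  - move=> x /=; rewrite in_itv/= andbT => x1.
    by rewrite lee_fin mulr_ge0// subr_ge0 exprn_ege1.
  - by apply: mfe; apply: measurable_funM => //; apply: measurable_funB.
  - by move=> x _; rewrite lee_fin.
  - exact: mfe.
by rewrite !split01// E2 addeA E1.
Qed.

Let symmetric_half (f : R -> R) : (forall x, 0 <= f x) -> continuous f -> f =1 f \o -%R ->
  (\int[leb]_x (f x)%:E = 2%:E * \int[leb]_(x in [set x | (0 <= x)%R]) (f x)%:E)%E.
Proof. exact: ge0_symfun_integralT. Qed.

Lemma normal01_second_moment : (\int[normal_prob 0 1]_x (x ^+ 2)%:E = (1 : \bar R))%E.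
Proof.
rewrite integral_normal_prob; last 2 first.
- by apply/measurable_EFinP; exact: exprn_measurable.
- by move=> x; rewrite lee_fin sqr_ge0.
have E (x : R) : normal_pdf 0 1 x = normal_peak 1 * g x.
  by rewrite normal_pdfE ?oner_neq0//= /normal_fun subr0 expr1n.
have p0 : 0 <= normal_peak (1 : R) by exact: normal_peak_ge0.
transitivity ((normal_peak 1)%:E * \int[leb]_x (x ^+ 2 * g x)%:E)%E.
  rewrite -ge0_integralZl//.
  - by apply: eq_integral => x _; rewrite E -!EFinM mulrCA.
  - by apply/measurable_EFinP.
  - by move=> x _; rewrite lee_fin.
transitivity ((normal_peak 1)%:E * \int[leb]_x (g x)%:E)%E.
  have cX2g : continuous (fun x : R => x ^+ 2 * g x).
    by apply: continuous_sqrM; exact: exprn_continuous.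
  have s1 : (fun x : R => x ^+ 2 * g x) =1 (fun x : R => x ^+ 2 * g x) \o -%R.
    by move=> x; rewrite /= /g sqrrN.
  have s2 : g =1 g \o -%R by move=> x; rewrite /= /g sqrrN.
  by rewrite (symmetric_half X2g0 cX2g s1) (symmetric_half g0 continuous_g s2) integral_0y.
rewrite -ge0_integralZl//.
- rewrite -[RHS](integral_normal_pdf 0 1).
  by apply: eq_integral => x _; rewrite E EFinM.
- by apply/measurable_EFinP.
- by move=> x _; rewrite lee_fin.
Qed.

End second_moment.

Section error_moments.
Context {R : realType}.
Local Notation leb := (@lebesgue_measure R).

Lemma integral_normal_prob_translation (a : R) (f : R -> \bar R) :
  measurable_fun setT f -> (forall x, 0 <= f x)%E ->
  (\int[normal_prob a 1]_x f x = \int[normal_prob 0 1]_x f (x + a)%R)%E.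
Proof.
move=> mf f0.
have mfa : measurable_fun setT (fun x : R => f (x + a)).
  by apply: (measurableT_comp mf); exact: measurable_funD.
have -> := integral_normal_prob a 1 mf f0.
have -> := integral_normal_prob 0 1 mfa (fun x => f0 _).
have mh : measurable_fun setT (fun x : R => (f x * (normal_pdf a 1 x)%:E)%E).
  by apply: emeasurable_funM => //; exact: measurable_EFin_normal_pdf.
have h0 (x : R) : (0 <= f x * (normal_pdf a 1 x)%:E)%E.
  by rewrite mule_ge0// EFin_normal_pdf_ge0.
have -> := ge0_integral_translation a measurableT mh h0.
rewrite preimage_setT; apply: eq_integral => x _.
by have := @normal_pdfD R 0 1 a x (oner_neq0 _); rewrite add0r => ->.
Qed.

Lemma integral_normal_probN (a : R) (f : R -> \bar R) :
  measurable_fun setT f -> (forall x, 0 <= f x)%E ->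
  (\int[normal_prob a 1]_x f (- x)%R = \int[normal_prob (- a) 1]_x f x)%E.
Proof.
move=> mf f0.
have mfN : measurable_fun setT (fun x : R => f (- x)).
  by apply: (measurableT_comp mf); exact: oppr_measurable.
have -> := integral_normal_prob a 1 mfN (fun x => f0 _).
have -> := integral_normal_prob (- a) 1 mf f0.
have mh : measurable_fun setT (fun x : R => (f x * (normal_pdf (- a) 1 x)%:E)%E).
  by apply: emeasurable_funM => //; exact: measurable_EFin_normal_pdf.
have h0 (x : R) : (0 <= f x * (normal_pdf (- a) 1 x)%:E)%E.
  by rewrite mule_ge0// EFin_normal_pdf_ge0.
have -> := ge0_integral_reflection measurableT mh h0.
rewrite preimage_setT; apply: eq_integral => x _.
by have -> := @normal_pdfN R a 1 x (oner_neq0 _).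
Qed.

(** By symmetry of the standard normal law, [(x + a)^2] and [(x - a)^2] have the same integral.
    Adding them removes the cross term, so that only nonnegative integrands occur. *)
Lemma normal_second_moment (a : R) :
  (\int[normal_prob a 1]_x (x ^+ 2)%:E = (1 + a ^+ 2)%:E)%E.
Proof.
have msq (D : set R) : measurable_fun D (fun x : R => (x ^+ 2)%:E).
  by apply/measurable_EFinP; exact: exprn_measurable.
have sq0 (x : R) : (0 <= (x ^+ 2)%:E)%E by rewrite lee_fin sqr_ge0.
have mDa (b : R) : measurable_fun setT (fun x : R => ((x + b) ^+ 2)%:E).
  by apply/measurable_EFinP; apply: measurable_funX; exact: measurable_funD.
set I := LHS.
have E1 : I = (\int[normal_prob 0 1]_x ((x + a) ^+ 2)%:E)%E.
  exact: (integral_normal_prob_translation a (msq setT) sq0).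
have E2 : I = (\int[normal_prob 0 1]_x ((x - a) ^+ 2)%:E)%E.
  rewrite E1.
  have := @integral_normal_probN 0 (fun x => ((x + a) ^+ 2)%:E) (mDa a) (fun x => sq0 _).
  rewrite oppr0 => <-; apply: eq_integral => x _.
  by rewrite -sqrrN opprD opprK.
have E : (I + I = (1 + a ^+ 2)%:E + (1 + a ^+ 2)%:E)%E.
  rewrite {1}E1 E2.
  have <- := @ge0_integralD _ _ R (normal_prob (0 : R) 1) setT measurableT
    (fun x : R => ((x + a) ^+ 2)%:E) (fun x : R => ((x - a) ^+ 2)%:E)
    (fun x _ => sq0 _) (mDa a) (fun x _ => sq0 _) (mDa (- a)).
  have q0 (x : R) : (0 <= (x ^+ 2)%:E + (a ^+ 2)%:E)%E by rewrite adde_ge0.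
  have mq : measurable_fun setT (fun x : R => (x ^+ 2)%:E + (a ^+ 2)%:E)%E.
    by apply: emeasurable_funD; [exact: msq|exact: measurable_cst].
  transitivity (\int[normal_prob 0 1]_x
      (((x ^+ 2)%:E + (a ^+ 2)%:E) + ((x ^+ 2)%:E + (a ^+ 2)%:E)))%E.
    by apply: eq_integral => x _; rewrite -!EFinD; congr EFin; ring.
  have -> := @ge0_integralD _ _ R (normal_prob (0 : R) 1) setT measurableT
    _ _ (fun x _ => q0 x) mq (fun x _ => q0 x) mq.
  have -> := @ge0_integralD _ _ R (normal_prob (0 : R) 1) setT measurableT
    _ _ (fun x _ => sq0 x) (msq setT) (fun x _ => sq0 a) (measurable_cst _).
  rewrite normal01_second_moment.
  suff -> : (\int[normal_prob 0 1]_x (a ^+ 2)%:E = (a ^+ 2)%:E)%E by [].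
  have -> := @integral_cst _ _ R (normal_prob (0 : R) 1) setT measurableT (a ^+ 2)%:E.
  rewrite -[RHS]mule1; congr (_ * _)%E; exact: (@probability_setT _ _ _ (normal_prob (0 : R) 1)).
have I0 : (0 <= I)%E by apply: integral_ge0.
clear E1 E2; clearbody I; case: I E I0 => [r| |]//=; rewrite -!EFinD => -[H] _; congr EFin; lra.
Qed.

Lemma ge0_integral_error_law disp (T : measurableType disp) (P : probability T R) m d
    (X : {RV P >-> R}) (f : R -> \bar R) :
  2 * mix_weight R m d <= 1 ->
  (forall A, measurable A -> distribution P X A = error_law m d A) ->
  measurable_fun setT f -> (forall x, 0 <= f x)%E ->
  (\int[P]_w f (X w) =
   \sum_(w <- noise_sum R m d 0) w.1%:E * \int[normal_prob w.2 1]_x f x)%E.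
Proof.
move=> hpi hX mf f0.
pose X' : {mfun T >-> measurableTypeR R} := HB.pack (X : T -> measurableTypeR R)
  (isMeasurableFun.Build _ _ T (measurableTypeR R) X (measurable_funPT X)).
transitivity (\int[distribution P X']_x f x)%E.
  by rewrite ge0_integral_pushforward.
apply: (@integral_mixture R (noise_sum R m d 0) 1 (distribution P X')) => //.
  exact: noise_sum_ge0.
by move=> A mA; rewrite -[RHS]error_lawE -hX.
Qed.

Lemma error_variance disp (T : measurableType disp) (P : probability T R) m d
    (X : {RV P >-> R}) :
  2 * mix_weight R m d <= 1 ->
  (forall A, measurable A -> distribution P X A = error_law m d A) ->
  ('V_P[X] = (1 + 2 * mix_weight R m d * mix_shift R m d ^+ 2)%:E)%E.
Proof.
move=> hpi hX.
have int f := @ge0_integral_error_law _ T P m d X f hpi hX.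
pose pos (x : R) : \bar R := maxe x%:E 0%:E.
have mpos : measurable_fun setT pos.
  by apply: measurable_maxe => //; exact/measurable_EFinP.
have pos0 x : (0 <= pos x)%E by rewrite /pos le_max lexx orbT.
have EX : fine 'E_P[X] = 0.
  rewrite unlock integralE.
  have -> : (\int[P]_w (fun w => (X w)%:E)^\+ w = \int[P]_w pos (X w))%E.
    by apply: eq_integral => w _; rewrite funeposE.
  have -> : (\int[P]_w (fun w => (X w)%:E)^\- w = \int[P]_w (fun x => pos (- x)%R) (X w))%E.
    by apply: eq_integral => w _; rewrite funenegE.
  have mposN : measurable_fun setT (fun x : R => pos (- x)).
    by apply: (measurableT_comp mpos); exact: oppr_measurable.
  have -> := int _ mpos pos0.
  have -> := int _ mposN (fun x => pos0 _).
  under [X in (_ - X)%E]eq_bigr => w _ do have -> := integral_normal_probN w.2 mpos pos0.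
  (* The positive and negative parts of the error have equal integrals. The infinite case is covered
     too, since [fine] is 0 at the infinities. *)
  have sub0 (y z : \bar R) : y = z -> fine (y - z)%E = 0.
    by move=> ->; case: z => [r| |]//=; rewrite subrr.
  apply: sub0; apply: esym.
  exact: (noise_sum_sym m d 0 (fun a b => a%:E * \int[normal_prob b 1]_x pos x)%E).
rewrite /variance unlock EX unlock.
transitivity (\int[P]_w (fun x : R => (x ^+ 2)%:E) (X w))%E.
  apply: eq_integral => w _; congr EFin.
  by change ((X w - 0) * (X w - 0) = X w ^+ 2); rewrite subr0 expr2.
have msq : measurable_fun setT (fun x : R => (x ^+ 2)%:E).
  by apply/measurable_EFinP; exact: exprn_measurable.
have sq0 (x : R) : (0 <= (x ^+ 2)%:E)%E by rewrite lee_fin sqr_ge0.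
have -> := int _ msq sq0.
under eq_bigr => w _ do rewrite normal_second_moment -EFinM.
rewrite sumEFin /= /noise !big_cons big_nil/=; congr EFin; ring.
Qed.

End error_moments.

(** * Column sums and selection events *)

Section measurable_sets.
Context d (T : measurableType d) (R : realType).
Implicit Types f g : T -> R.

Lemma measurable_le_set f g : measurable_fun setT f -> measurable_fun setT g ->
  measurable [set w | f w <= g w].
Proof. by move=> mf mg; rewrite -[X in measurable X]setTI; apply: measurable_fun_ler. Qed.

Lemma measurable_lt_set f g : measurable_fun setT f -> measurable_fun setT g ->
  measurable [set w | f w < g w].
Proof. by move=> mf mg; rewrite -[X in measurable X]setTI; apply: measurable_fun_ltr. Qed.

Lemma measurable_eq_set f g : measurable_fun setT f -> measurable_fun setT g ->
  measurable [set w | f w = g w].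
Proof.
move=> mf mg; have -> : [set w | f w = g w] = [set w | f w == g w].
  by apply/seteqP; split => w /eqP.
by rewrite -[X in measurable X]setTI; apply: measurable_fun_eqr.
Qed.

End measurable_sets.

Lemma measurable_abs_le (R : realType) (z : R) : measurable [set x : R | `|x| <= z].
Proof.
rewrite (_ : [set x : R | `|x| <= z] = `[(- z)%R, z]%classic)//.
by apply/seteqP; split => x /=; rewrite in_itv/= ler_norml.
Qed.

Lemma measurable_bigmaxr d (T : measurableType d) (R : realType) (I : Type) (r : seq I)
    (Q : pred I) (f : I -> T -> R) :
  (forall i, Q i -> measurable_fun setT (f i)) ->
  measurable_fun setT (fun w => \big[Num.max/0]_(i <- r | Q i) f i w).
Proof.
move=> mf; elim: r => [|i r IH].
  by under eq_fun do rewrite big_nil; exact: measurable_cst.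
under eq_fun do rewrite big_cons.
have [Qi|//] := boolP (Q i).
exact: measurable_maxr (mf i Qi) IH.
Qed.

Section columns.
Context disp (T : measurableType disp) (R : realType) (P : probability T R) (m d : nat).
Variable eps : 'I_m -> 'I_d -> {RV P >-> R}.
Hypothesis heps : iid_errors eps.
Hypothesis hpi : 2 * mix_weight R m d <= 1.
Local Notation noise_sum := (noise_sum R m d).

Definition column_sum (j : 'I_d) (w : T) : R := \sum_(i < m) eps i j w.

Definition rest_max (j : 'I_d) (w : T) : R :=
  \big[Num.max/0]_(l < d | l != j) `|column_sum l w|.

Let eps' (ij : 'I_m * 'I_d) := eps ij.1 ij.2.

(** One statement for three groupings: by column, one column against the others, and the first rows
    against the later ones. *)
Lemma measurable_column_sum_grouped (K : finType) (kappa : 'I_m * 'I_d -> K) k (Q : pred 'I_m) j :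
  (forall i, Q i -> kappa (i, j) = k) ->
  measurable_fun setT ((fun w => \sum_(i < m | Q i) eps i j w)
    : g_sigma_algebraType (grouped_events kappa eps' k) -> R).
Proof.
move=> Qk; under eq_fun do rewrite big_mkcond.
apply: measurable_sum => i.
have [Qi|_] := boolP (Q i); last exact: measurable_cst.
rewrite -(Qk i Qi).
exact: (@measurable_grouped _ _ _ _ _ _ kappa eps' (i, j)).
Qed.

Lemma measurable_column_sum j : measurable_fun setT (column_sum j).
Proof. by apply: measurable_sum => i; exact: measurable_funPT. Qed.

Lemma measurable_rest_max j : measurable_fun setT (rest_max j).
Proof.
apply: measurable_bigmaxr => l _; apply: measurableT_comp => //.
exact: measurable_column_sum.
Qed.

(** Induction on the last row: each step adds one error, independent of the rows before it. As in
    [noise_sum], index [k] stands for [k.+1] summands. *)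
Lemma partial_column_sum_law j k (A : set R) : (k < m)%N -> measurable A ->
  P ((fun w => \sum_(i < m | (i <= k)%N) eps i j w) @^-1` A) =
  mixture (noise_sum k) (Num.sqrt k.+1%:R) A.
Proof.
have law1 (i : 'I_m) (B : set R) : measurable B -> P (eps i j @^-1` B) = mixture (noise_sum 0) 1 B.
  by move=> mB; have := heps.1 i j B mB; rewrite error_lawE.
elim: k A => [|k IH] A km mA.
  rewrite sqrtr1 -(law1 (Ordinal km))//; congr (P _).
  apply/seteqP; split => w /=; rewrite (big_pred1 (Ordinal km))// => i;
    exact: leqn0.
pose X := fun w => \sum_(i < m | (i <= k)%N) eps i j w.
have mX : measurable_fun setT X.
  rewrite /X; under eq_fun do rewrite big_mkcond.
  apply: measurable_sum => i.
  by have [_|_] := boolP (i <= k)%N; [exact: measurable_funPT|exact: measurable_cst].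
pose X' : {RV P >-> R} := HB.pack X (isMeasurableFun.Build _ _ _ _ _ mX).
pose i := Ordinal km.
pose Y := eps i j.
transitivity (P ((fun w => X' w + Y w) @^-1` A)).
  congr (P _); apply/seteqP; split => w /=;
    rewrite (bigD1 i)//= addrC; congr (A (_ + _)); apply: eq_bigl => l;
    by rewrite -val_eqE /= andbC -ltn_neqAle ltnS.
have XY (A1 A2 : set R) : measurable A1 -> measurable A2 ->
  P (X' @^-1` A1 `&` Y @^-1` A2) = (P (X' @^-1` A1) * P (Y @^-1` A2))%E.
  move=> mA1 mA2.
  pose kappa (ij : 'I_m * 'I_d) := (ij.1 <= k)%N.
  pose f (b : bool) : T -> R := if b then X else Y.
  have := @independence_grouped _ _ _ P _ _ kappa eps' f heps.2.
  move=> /(_ _ (fun b => if b then A1 else A2)) H.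
  have {}H := H _ _.
  rewrite big_bool /= in H; rewrite -H//.
  + congr (P _); apply/seteqP; split => [w [w1 w2] [] _//|w Hw].
    by split; [exact: (Hw true)|exact: (Hw false)].
  + case; first exact: (@measurable_column_sum_grouped _ kappa true (fun i => i <= k)%N j).
    have -> : f false = fun w => \sum_(l < m | l == i) eps l j w.
      by apply/funext => w; rewrite big_pred1_eq.
    apply: (@measurable_column_sum_grouped _ kappa false (pred1 i) j) => l /eqP ->.
    by rewrite /kappa/= ltnn.
  + by case.
have IH' B : measurable B -> P (X' @^-1` B) = mixture (noise_sum k) (Num.sqrt k.+1%:R) B.
  by move=> mB; apply: IH => //; exact: ltnW.
have k0 : 0 < Num.sqrt k.+1%:R :> R by rewrite sqrtr_gt0 ltr0n.
have wge0 l w : w \in noise_sum l -> 0 <= w.1 by exact: noise_sum_ge0.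
have H := mixture_convolution XY (@wge0 k) (@wge0 0%N) k0 ltr01 IH' (law1 i) mA.
have E : Num.sqrt (Num.sqrt k.+1%:R ^+ 2 + 1 ^+ 2) = Num.sqrt k.+2%:R :> R.
  by rewrite sqr_sqrtr// expr1n natr1.
rewrite -E; exact: H.
Qed.

Hypothesis hm : (0 < m)%N.

Lemma column_sum_law j (A : set R) : measurable A ->
  P (column_sum j @^-1` A) = mixture (noise_sum m.-1) (Num.sqrt m%:R) A.
Proof.
move=> mA; have := @partial_column_sum_law j m.-1 A; rewrite prednK// => <-//.
congr (P _); apply/seteqP; split => w /=; rewrite /column_sum;
  rewrite (eq_bigl predT)// => i; by rewrite -ltnS prednK// ltn_ord.
Qed.

Lemma independent_columns (A : 'I_d -> set R) : (forall j, measurable (A j)) ->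
  P (\bigcap_j (column_sum j @^-1` A j)) = (\prod_j P (column_sum j @^-1` A j))%E.
Proof.
move=> mA; apply: (independence_grouped heps.2 (kappa := snd)) => // j.
exact: (@measurable_column_sum_grouped _ snd j predT j).
Qed.

Lemma independent_rest j (A B : set R) : measurable A -> measurable B ->
  P (column_sum j @^-1` A `&` rest_max j @^-1` B) =
  (P (column_sum j @^-1` A) * P (rest_max j @^-1` B))%E.
Proof.
move=> mA mB.
pose kappa (ij : 'I_m * 'I_d) := ij.2 == j.
pose f (b : bool) := if b then column_sum j else rest_max j.
have H := @independence_grouped _ _ _ P _ _ kappa eps' f heps.2 _
  (fun b => if b then A else B) _.
rewrite big_bool /= in H; rewrite -H//.
- congr (P _); apply/seteqP; split => [w [w1 w2] [] _//|w Hw].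
  by split; [exact: (Hw true)|exact: (Hw false)].
- case; first by apply: (@measurable_column_sum_grouped _ kappa true predT j) => i _; exact: eqxx.
  apply: measurable_bigmaxr => l lj; apply: measurableT_comp => //.
  apply: (@measurable_column_sum_grouped _ kappa false predT l) => i _.
  exact: negbTE.
- by case.
Qed.

Lemma rest_max_le_law j (z : R) : 0 <= z ->
  P [set w | rest_max j w <= z] =
  (\prod_(l < d | l != j) P [set w | (`|column_sum l w| <= z)%R])%E.
Proof.
move=> z0.
pose A l := if l == j then setT else [set x : R | `|x| <= z].
have mA l : measurable (A l).
  by rewrite /A; case: ifP => // _; exact: measurable_abs_le.
transitivity (P (\bigcap_l (column_sum l @^-1` A l))).
  congr (P _); apply/seteqP; split => w /=.
    move=> /bigmax_leP[_ H] l _; rewrite /A /=.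
    by have [->//|lj] := eqVneq l j; exact: H.
  move=> H; apply/bigmax_leP; split=> // l lj.
  by have := H l I; rewrite /A /= (negbTE lj).
rewrite independent_columns// (bigD1 j)//= /A eqxx preimage_setT probability_setT mul1e.
by apply: eq_bigr => l /negbTE ->.
Qed.

End columns.

Lemma le_measure_bigcup_fin d (T : measurableType d) (R : realType)
    (mu : {measure set T -> \bar R}) (I : finType) (Q : pred I) (F : I -> set T) :
  (forall i, Q i -> measurable (F i)) ->
  (mu (\bigcup_(i in [set i | Q i]) F i) <= \sum_(i | Q i) mu (F i))%E.
Proof.
move=> mF; have -> : \bigcup_(i in [set i | Q i]) F i = \big[setU/set0]_(i | Q i) F i.
  by rewrite -bigcup_seq_cond; apply: eq_bigcupl => //; split => i /=; rewrite mem_index_enum.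
have : measurable (\big[setU/set0]_(i | Q i) F i) /\
    (mu (\big[setU/set0]_(i | Q i) F i) <= \sum_(i | Q i) mu (F i))%E; last by case.
elim/big_rec2 : _ => [|i y A Qi [mA Ay]]; first by rewrite measure0.
split; first by apply: measurableU => //; exact: mF.
by rewrite (le_trans (measureU2 _ _ _))// ?leeD2l//; exact: mF.
Qed.

Lemma measure_bigcup_ord d (T : measurableType d) (R : realType)
    (mu : {measure set T -> \bar R}) n (F : 'I_n -> set T) :
  (forall i, measurable (F i)) -> trivIset setT F ->
  mu (\bigcup_i F i) = (\sum_i mu (F i))%E.
Proof.
move=> mF tF; rewrite -(measure_bigsetU_ord mu xpredT mF tF); congr (mu _).
by rewrite -bigcup_pred; apply: eq_bigcupl.
Qed.

(** The base is the inverse of [1 + 1/(n-1)], which is at most [exp (1/(n-1))]. The exponent [n.-1],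
    the number of competing columns, matters: with exponent [n] the inequality is reversed. *)
Lemma expR_le_binomial (R : realType) (n : nat) : (0 < n)%N ->
  expR (-1) <= (1 - n%:R^-1) ^+ n.-1 :> R.
Proof.
case: n => // -[|n] _; first by rewrite expr0 -[leRHS]expR0 ler_expR lerN10.
rewrite [_.-1]/=.
have n0 : 0 < n.+1%:R :> R by [].
have -> : 1 - n.+2%:R^-1 = (1 + n.+1%:R^-1)^-1 :> R.
  have h1 : n.+2%:R = n.+1%:R + 1 :> R by rewrite natr1.
  rewrite h1; field; rewrite ?gt_eqF//; lra.
have n1 : 0 < 1 + n.+1%:R^-1 :> R by rewrite addr_gt0// invr_gt0.
rewrite expRN exprVn lef_pV2 ?posrE ?expR_gt0 ?exprn_gt0//.
have -> : expR 1 = expR n.+1%:R^-1 ^+ n.+1 :> R.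
  by rewrite -expRM_natl mulfV// gt_eqF.
rewrite lerXn2r ?nnegrE ?expR_ge0 ?addr_ge0 ?invr_ge0//.
exact: expR_ge1Dx.
Qed.

(** * Probabilities of the selection events *)

Section selection.
Context disp (T : measurableType disp) (R : realType) (P : probability T R) (m d : nat).
Variable eps : 'I_m -> 'I_d -> {RV P >-> R}.
Hypothesis heps : iid_errors eps.
Hypothesis hpi : 2 * mix_weight R m d <= 1.
Hypothesis hm : (0 < m)%N.

(* The sign [s] of a selected model is encoded as [(-1) ^+ b]. *)
Definition signed_sum (b : bool) (j : 'I_d) (w : T) : R := (-1) ^+ b * column_sum eps j w.

Lemma measurable_signed_sum b j : measurable_fun setT (signed_sum b j).
Proof. by apply: measurable_funM => //; exact: measurable_column_sum. Qed.

HB.instance Definition _ b j := isMeasurableFun.Build _ _ _ _ _ (measurable_signed_sum b j).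
HB.instance Definition _ j := isMeasurableFun.Build _ _ _ _ _ (measurable_rest_max eps j).

Definition column_law (A : set R) : \bar R := mixture (noise_sum R m d m.-1) (Num.sqrt m%:R) A.

Let sqrtm0 : Num.sqrt m%:R != 0 :> R.
Proof. by rewrite gt_eqF// sqrtr_gt0 ltr0n. Qed.

Lemma column_lawN (A : set R) : measurable A -> column_law (-%R @^-1` A) = column_law A.
Proof. by move=> mA; rewrite /column_law mixture_noise_sumN. Qed.

Lemma column_law_set1 x : column_law [set x] = 0%E.
Proof. exact: mixture_noise_sum_set1. Qed.

Lemma signed_sum_law b j (A : set R) : measurable A -> P (signed_sum b j @^-1` A) = column_law A.
Proof.
move=> mA; case: b.
  rewrite -column_lawN// /column_law -(column_sum_law heps hpi hm j).
    by congr (P _); apply/seteqP; split => w; rewrite /signed_sum /= expr1 mulN1r.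
  by rewrite -[X in measurable X]setTI; exact: oppr_measurable.
rewrite /column_law -(column_sum_law heps hpi hm j)//.
by congr (P _); apply/seteqP; split => w; rewrite /signed_sum /= expr0 mul1r.
Qed.

Lemma independent_signed_rest b j (A C : set R) : measurable A -> measurable C ->
  P (signed_sum b j @^-1` A `&` rest_max eps j @^-1` C) =
  (P (signed_sum b j @^-1` A) * P (rest_max eps j @^-1` C))%E.
Proof.
move=> mA mC.
have -> : signed_sum b j @^-1` A = column_sum eps j @^-1` ((fun x => (-1) ^+ b * x) @^-1` A) by [].
apply: (independent_rest heps) => //.
by rewrite -[X in measurable X]setTI; exact: (measurable_funM (measurable_cst _) (@measurable_id _ _ _)).
Qed.

(** Stated for every real [z], because [z] becomes the integration variable in [selection_prob]; the
    value is 0 for negative [z] since [rest_max] is nonnegative. *)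
Lemma rest_max_le j z : P [set w | rest_max eps j w <= z] =
  if 0 <= z then ((fine (column_law [set x | `|x| <= z])) ^+ d.-1)%:E else 0%E.
Proof.
case: ifPn => [z0|]; last first.
  rewrite -ltNge => z0; rewrite (_ : [set w | _] = set0) ?measure0//.
  apply/seteqP; split => // w /= H; have := le_lt_trans H z0.
  by rewrite ltNge /rest_max bigmax_idl; rewrite le_max lexx.
rewrite (rest_max_le_law heps)//.
have mz := measurable_abs_le z.
have E l : P [set w | `|column_sum eps l w| <= z] = (fine (column_law [set x | `|x| <= z]))%:E.
  rewrite -(signed_sum_law false l mz) fineK; last first.
    exact/fin_num_measure/measurable_funPTI.
  by congr (P _); apply/seteqP; split => w; rewrite /= /signed_sum expr0 mul1r.
under eq_bigr do rewrite E.
rewrite -(big_morph EFin EFinM erefl) prodr_const; congr (_ ^+ _)%:E.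
by rewrite cardC1 card_ord.
Qed.

(** Conditioning on the signed sum. Neither the integrand nor the law of the signed sum depends on
    [b] or [j], which makes all models equally likely. *)
Lemma selection_prob b j : P [set w | rest_max eps j w <= signed_sum b j w] =
  (\int[distribution P (signed_sum b j)]_x
     (if (0 <= x)%R then ((fine (column_law [set y | `|y| <= x]%R)) ^+ d.-1)%:E else 0%:E))%E.
Proof.
pose C : set (R * R) := [set z | z.2 <= z.1].
have mC : measurable C.
  rewrite -[C]setTI; apply: (measurable_fun_ler measurable_snd measurable_fst) => //.
transitivity (P ((fun w => (signed_sum b j w, rest_max eps j w)) @^-1` C)) => //.
rewrite (@independent_pair_law _ _ _ _ _ _ _ P (signed_sum b j) (rest_max eps j))//.
  apply: eq_integral => x _; rewrite -(rest_max_le j)//; congr (P _).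
  by apply/seteqP; split => w; rewrite /xsection/= inE.
exact: independent_signed_rest.
Qed.

Lemma selection_prob_eq b j b' j' :
  P [set w | rest_max eps j w <= signed_sum b j w] =
  P [set w | rest_max eps j' w <= signed_sum b' j' w].
Proof.
rewrite !selection_prob; apply: eq_measure_integral => A mA _.
by transitivity (column_law A); [exact: signed_sum_law|exact/esym/signed_sum_law].
Qed.

(** Given the rest, a tie fixes the signed sum at one point, and its law has no atoms. Weak
    selection can thus be exchanged with strict selection, whose events are disjoint. *)
Lemma selection_tie b j : P [set w | rest_max eps j w = signed_sum b j w] = 0%E.
Proof.
pose C : set (R * R) := [set z | z.1 == z.2].
have mC : measurable C.
  rewrite -[C]setTI; apply: (measurable_fun_eqr measurable_fst measurable_snd) => //.
transitivity (P ((fun w => (rest_max eps j w, signed_sum b j w)) @^-1` C)).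
  by congr (P _); apply/seteqP; split => w /eqP.
rewrite (@independent_pair_law _ _ _ _ _ _ _ P (rest_max eps j) (signed_sum b j))//.
  apply: integral0_eq => x _.
  rewrite (_ : _ @^-1` _ = signed_sum b j @^-1` [set x]); last first.
    apply/seteqP; split => w; rewrite /xsection/= inE; last by move=> <-; exact: eqxx.
    by move=> /eqP.
  by rewrite signed_sum_law// column_law_set1.
by move=> A B mA mB; rewrite setIC independent_signed_rest// muleC.
Qed.

Lemma measurable_tie b j : measurable [set w | rest_max eps j w = signed_sum b j w].
Proof. exact: measurable_eq_set (measurable_rest_max eps j) (measurable_signed_sum b j). Qed.

Lemma measurable_selection b j : measurable [set w | rest_max eps j w <= signed_sum b j w].
Proof. exact: measurable_le_set (measurable_rest_max eps j) (measurable_signed_sum b j). Qed.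

Lemma measurable_strict_selection b j :
  measurable [set w | rest_max eps j w < signed_sum b j w].
Proof. exact: measurable_lt_set (measurable_rest_max eps j) (measurable_signed_sum b j). Qed.

Lemma strict_selection_prob b j : P [set w | rest_max eps j w < signed_sum b j w] =
  P [set w | rest_max eps j w <= signed_sum b j w].
Proof.
have -> : [set w | rest_max eps j w <= signed_sum b j w] =
   [set w | rest_max eps j w < signed_sum b j w] `|` [set w | rest_max eps j w = signed_sum b j w].
  apply/seteqP; split => w /=; rewrite le_eqVlt.
    by move=> /orP[/eqP|]; [right|left].
  by case=> [->|->]; rewrite ?eqxx ?orbT.
rewrite measureU//.
- by rewrite -[LHS]adde0; congr (_ + _)%E; exact/esym/selection_tie.
- exact: measurable_strict_selection.
- exact: measurable_tie.
- by apply/seteqP; split => // w /= [H E]; move: H; rewrite E ltxx.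
Qed.

Lemma rest_max_ge0 j w : 0 <= rest_max eps j w.
Proof. by rewrite /rest_max bigmax_idl le_max lexx. Qed.

Lemma le_rest_max l j w : l != j -> `|column_sum eps l w| <= rest_max eps j w.
Proof. by move=> lj; exact: (le_bigmax_cond _ (fun l => `|column_sum eps l w|)). Qed.

Lemma signed_sum_le b j w : signed_sum b j w <= `|column_sum eps j w|.
Proof.
rewrite /signed_sum; case: b; rewrite ?expr0 ?expr1 ?mul1r ?mulN1r ?ler_norm//.
by rewrite -normrN ler_norm.
Qed.

(* The [2 * d] strict selection events are disjoint and have the same probability. *)
Lemma selection_prob_le b j :
  (P [set w | rest_max eps j w <= signed_sum b j w]%R <= ((2 * d%:R)^-1)%:E)%E.
Proof.
set q := P _.
have qE b' j' : P [set w | rest_max eps j' w < signed_sum b' j' w] = q.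
  by rewrite strict_selection_prob; exact: selection_prob_eq.
pose G b' j' := [set w | rest_max eps j' w < signed_sum b' j' w].
pose F j' := G false j' `|` G true j'.
have mF j' : measurable (F j') by apply: measurableU; exact: measurable_strict_selection.
have Fgt j' w : F j' w -> rest_max eps j' w < `|column_sum eps j' w|.
  by case=> /= H; apply: (lt_le_trans H); exact: signed_sum_le.
have tF : trivIset setT F.
  apply/trivIsetP => j1 j2 _ _ j12; apply/seteqP; split => // w [/Fgt H1 /Fgt H2].
  have j21 : j2 != j1 by rewrite eq_sym.
  have := lt_trans (le_lt_trans (le_rest_max w j12) H2) (le_lt_trans (le_rest_max w j21) H1).
  by rewrite ltxx.
have PF j' : P (F j') = (q + q)%E.
  rewrite measureU.
  - by congr (_ + _)%E; exact: qE.
  - exact: measurable_strict_selection.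
  - exact: measurable_strict_selection.
  apply/seteqP; split => // w [] /= H1 H2.
  have := le_lt_trans (rest_max_ge0 j' w) H1; have := le_lt_trans (rest_max_ge0 j' w) H2.
  by rewrite /signed_sum expr0 expr1 mul1r mulN1r oppr_gt0 => /ltW; rewrite leNgt => /negP.
have PU : P (\bigcup_i F i) = (\sum_(i < d) (q + q))%E.
  by rewrite (measure_bigcup_ord P mF tF); apply: eq_bigr => i _; exact: PF.
have fq : q \is a fin_num by exact/fin_num_measure/measurable_selection.
have le1 : (P (\bigcup_i F i) <= 1)%E.
  by apply: probability_le1; apply: fin_bigcup_measurable => //; exact: finite_finset.
rewrite PU -(fineK fq) -EFinD sumEFin sumr_const card_ord in le1.
rewrite -(fineK fq).
have d0 : 0 < d%:R :> R by rewrite ltr0n (leq_ltn_trans _ (ltn_ord j)).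
rewrite lee_fin -[leRHS]mul1r ler_pdivlMr ?mulr_gt0//.
move: le1; rewrite lee_fin -mulr_natr; lra.
Qed.

End selection.

(** * The extreme quantile and near ties *)

(** Let [s] be the supremum of the points whose upper tail has mass at least [q]; the set is bounded
    since the tail tends to 0. Approaching [s] from the left gives mass at least [q] on the closed
    tail, from the right at most [q] on the open one; without atoms the two coincide. *)
Lemma atomless_quantile d (T : measurableType d) (R : realType) (P : probability T R)
    (X : {RV P >-> R}) (x0 q : R) : 0 < q ->
  (forall x, P (X @^-1` [set x]) = 0%E) ->
  (q%:E <= P (X @^-1` `[x0, +oo[))%E ->
  exists2 x, x0 <= x & P (X @^-1` `[x, +oo[) = q%:E.
Proof.
move=> q0 X0 qx0.
pose A := [set x : R | (q%:E <= P (X @^-1` `[x, +oo[))%E].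
have mX (i : interval R) : measurable (X @^-1` [set` i]) by exact: measurable_funPTI.
have leX (i1 i2 : interval R) : [set` i1] `<=` [set` i2] ->
    (P (X @^-1` [set` i1]) <= P (X @^-1` [set` i2]))%E.
  by move=> i12; apply: le_measure; rewrite ?inE//; exact: preimage_subset.
have supA : has_sup A.
  split; first by exists x0.
  have := @cvg_ccdfy0 _ _ _ P X [set y | (y < q%:E)%E].
  move=> /(_ _)[|M [_ HM]].
    by apply: (@open_ereal_lt' _ 0%E q%:E); rewrite lte_fin.
  exists (M + 1) => x Ax; rewrite leNgt; apply/negP => Mx.
  have M1 : M < M + 1 by rewrite ltrDl.
  have : (P (X @^-1` `](M + 1)%R, +oo[) < q%:E)%E := HM _ M1.
  rewrite ltNge => /negP; apply; apply: (le_trans Ax); apply: leX => y /=.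
  by rewrite !in_itv/= !andbT; exact: lt_le_trans.
pose s := sup A.
have As x : A x -> x <= s by move=> Ax; exact: sup_ubound (proj2 supA) _ Ax.
exists s; first exact: As.
apply/eqP; rewrite eq_le; apply/andP; split; last first.
  rewrite itvcyEbigcap preimage_bigcap.
  apply: (@cvge_ge _ \oo%classic _ _ (P \o (fun k => X @^-1` `]s - k.+1%:R^-1, +oo[))).
    apply: nearW => k /=.
    have [||a Aa sa] := @sup_adherent _ A k.+1%:R^-1; rewrite ?invr_gt0//.
    apply: (le_trans Aa); apply: leX => x /=; rewrite !in_itv/= !andbT.
    exact: lt_le_trans.
  apply: nonincreasing_cvg_mu => //.
  - by rewrite (le_lt_trans (probability_le1 _ _)) ?ltry//.
  - by rewrite -preimage_bigcap -itvcyEbigcap.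
  - move=> k l kl; apply/subsetPset => w; rewrite /= !in_itv/= !andbT; apply: le_lt_trans.
    by rewrite lerD2l lerN2 lef_pV2 ?posrE// ler_nat.
have -> : P (X @^-1` `[s, +oo[) = P (X @^-1` `]s, +oo[).
  have -> : `[s, +oo[%classic = [set s] `|` `]s, +oo[%classic :> set R by rewrite setU1itv.
  rewrite preimage_setU measureU//.
    by rewrite -[RHS]add0e; congr (_ + _)%E; exact: X0.
  by apply/seteqP; split => // w /= [->]; rewrite in_itv/= ltxx.
rewrite itvoyEbigcup preimage_bigcup.
apply: (@cvge_le _ \oo%classic _ _ (P \o (fun k => X @^-1` `[s + k.+1%:R^-1, +oo[))).
  apply: nearW => k /=; rewrite leNgt; apply/negP => H.
  have := As _ (ltW H); rewrite leNgt ltrDl invr_gt0 ltr0n; by [].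
apply: nondecreasing_cvg_mu => //.
- by rewrite -preimage_bigcup -itvoyEbigcup.
- move=> k l kl; apply/subsetPset => w; rewrite /= !in_itv/= !andbT; apply: le_trans.
  by rewrite lerD2l lef_pV2 ?posrE// ler_nat.
Qed.

Lemma mix_weight_expr (R : realType) (m d : nat) : (0 < m)%N ->
  mix_weight R m d ^+ m = d%:R^-1.
Proof.
move=> m0; rewrite /mix_weight -powR_mulrn ?powR_ge0// -powRrM mulVf ?powRr1//.
by rewrite pnatr_eq0 -lt0n.
Qed.

Section extreme_columns.
Context disp (T : measurableType disp) (R : realType) (P : probability T R) (m d : nat).
Variable eps : 'I_m -> 'I_d -> {RV P >-> R}.
Hypothesis heps : iid_errors eps.
Hypothesis hpi : 2 * mix_weight R m d <= 1.
Hypothesis hm : (0 < m)%N.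
Variable j0 : 'I_d.
Local Notation column_law := (@column_law R m d).
Local Notation q := ((2 * d%:R)^-1 : R).
Local Notation S := (signed_sum eps).
Local Notation M := (rest_max eps).

Let d0 : 0 < d%:R :> R. Proof. by rewrite ltr0n (leq_ltn_trans _ (ltn_ord j0)). Qed.

Let column_lawE (A : set R) : measurable A -> column_law A = P (S false j0 @^-1` A).
Proof. by move=> mA; rewrite -(signed_sum_law heps hpi hm false j0). Qed.

Lemma column_law_ge0 (A : set R) : measurable A -> (0 <= column_law A)%E.
Proof. by move=> mA; rewrite column_lawE. Qed.

Lemma column_law_fin_num (A : set R) : measurable A -> column_law A \is a fin_num.
Proof. by move=> mA; rewrite column_lawE//; exact/fin_num_measure/measurable_funPTI. Qed.

Lemma column_lawU (A B : set R) : measurable A -> measurable B -> A `&` B = set0 ->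
  column_law (A `|` B) = (column_law A + column_law B)%E.
Proof.
move=> mA mB AB; rewrite !column_lawE//; last exact: measurableU.
rewrite preimage_setU; apply: measureU; [exact: measurable_funPTI..|].
apply/seteqP; split => // w H; have : (A `&` B) (S false j0 w) by [].
by rewrite AB.
Qed.

Lemma le_column_law (A B : set R) : measurable A -> measurable B -> A `<=` B ->
  (column_law A <= column_law B)%E.
Proof.
move=> mA mB AB; rewrite !column_lawE//; apply: le_measure; rewrite ?inE; [exact: measurable_funPTI..|].
exact: preimage_subset.
Qed.

Lemma column_law_oy x : column_law `]x, +oo[ = column_law `[x, +oo[.
Proof.
have <- : [set x] `|` `]x, +oo[%classic = `[x, +oo[%classic by rewrite setU1itv.
rewrite column_lawU//; first by rewrite column_law_set1 add0e.
by apply/seteqP; split => // y /= [->]; rewrite in_itv/= ltxx.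
Qed.

Lemma column_law_quantile : exists2 x, m%:R * mix_shift R m d <= x & column_law `[x, +oo[ = q%:E.
Proof.
have [|z||x Hx qx] := @atomless_quantile _ _ _ P (S false j0) (m%:R * mix_shift R m d) q.
- by rewrite invr_gt0 mulr_gt0.
- by rewrite -column_lawE ?column_law_set1.
- have sm : Num.sqrt m%:R != 0 :> R by rewrite gt_eqF// sqrtr_gt0 ltr0n.
  have := mixture_noise_sum_ge hpi m.-1 sm; rewrite prednK// mix_weight_expr//.
  by rewrite (_ : d%:R^-1 / 2 = q) -?column_lawE// invfM mulrC.
- by exists x => //; rewrite column_lawE.
Qed.

(** By symmetry each of the two tails beyond [x] has mass [1/(2d)]. *)
Lemma column_law_abs_le x : 0 <= x -> column_law `[x, +oo[ = q%:E ->
  fine (column_law [set y | `|y| <= x]) = 1 - d%:R^-1.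
Proof.
move=> x0 qx.
have -> : [set y : R | `|y| <= x] = `[(- x)%R, x]%classic.
  by apply/seteqP; split => y /=; rewrite in_itv/= ler_norml.
have H1 : column_law setT = 1%E by rewrite column_lawE// preimage_setT probability_setT.
have E : [set: R] = `]-oo, (- x)%R[ `|` (`[(- x)%R, x] `|` `]x, +oo[).
  apply/seteqP; split => // y _ /=; rewrite !in_itv/= andbT.
  case: (ltP y (- x)); first by left.
  by case: (leP y x); [right; left|right; right].
have E2 : column_law `]-oo, (- x)%R[ = q%:E.
  rewrite -qx -column_law_oy -column_lawN//; congr (column_law _).
  by apply/seteqP; split => y /=; rewrite !in_itv/= andbT ltrN2.
rewrite E column_lawU// in H1; last 2 first.
- exact: measurableU.
- apply/seteqP; split => // y /= [+ [|]]; rewrite !in_itv/= ?andbT.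
    by move=> yx /andP[]; rewrite leNgt yx.
  by move=> yx xy; have := lt_trans xy yx; rewrite ltNge ge0_cp.
rewrite column_lawU// in H1; last first.
  apply/seteqP; split => // y /= []; rewrite !in_itv/= ?andbT => /andP[_].
  by rewrite leNgt => /negP.
rewrite E2 column_law_oy qx in H1.
have f := column_law_fin_num (measurable_itv `[(- x)%R, x]).
move: H1; rewrite -(fineK f) -!EFinD => -[].
have -> : q = d%:R^-1 / 2 by rewrite invfM mulrC.
lra.
Qed.

Lemma selected_extreme_ge b j x : 0 <= x -> column_law `[x, +oo[ = q%:E ->
  ((expR (-1) * q)%:E <= P ([set w | x <= S b j w]%R `&` [set w | M j w <= S b j w]%R))%E.
Proof.
move=> x0 qx.
have mA : measurable ([set w | (x <= S b j w)%R]).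
  rewrite (_ : [set w | _] = S b j @^-1` `[x, +oo[); first exact: measurable_funPTI.
  by apply/seteqP; split => w; rewrite /= in_itv/= andbT.
have mC : measurable ([set w | (M j w <= x)%R]).
  rewrite (_ : [set w | _] = M j @^-1` `]-oo, x]); first exact: measurable_funPTI.
  by apply/seteqP; split => w; rewrite /= in_itv/=.
apply: (@le_trans _ _ (P ([set w | x <= S b j w]%R `&` [set w | M j w <= x]%R))); last first.
  apply: le_measure; rewrite ?inE; [exact: measurableI| |].
    by apply: measurableI => //; exact: measurable_selection.
  by move=> w [/= xS Mx]; split => //=; exact: le_trans xS.
have -> : [set w | (x <= S b j w)%R] = S b j @^-1` `[x, +oo[.
  by apply/seteqP; split => w; rewrite /= in_itv/= andbT.
have E : [set w | (M j w <= x)%R] = M j @^-1` `]-oo, x].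
  by apply/seteqP; split => w; rewrite /= in_itv/=.
rewrite E independent_signed_rest// -E rest_max_le// x0 signed_sum_law// qx -EFinM lee_fin.
rewrite mulrC ler_pM2l ?invr_gt0 ?mulr_gt0// column_law_abs_le//.
by apply: expR_le_binomial; rewrite -(ltr0n R).
Qed.

(** Union bound over the columns: the maximum is attained by some column, whose sum or its negative
    lies in the interval, hence the factor 2. *)
Lemma rest_max_interval_le j y delta kappa : 0 <= delta -> delta <= y ->
  (column_law `](y - delta)%R, y] <= kappa%:E)%E ->
  (P (M j @^-1` `](y - delta)%R, y]) <= (d%:R * (2 * kappa))%:E)%E.
Proof.
move=> delta0 dy hk.
have k0 : 0 <= kappa by rewrite -lee_fin; apply: le_trans hk; exact: column_law_ge0.
have PE b l : (P (S b l @^-1` `](y - delta)%R, y]) <= kappa%:E)%E.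
  by rewrite (signed_sum_law heps hpi hm b l).
pose F l := S false l @^-1` `](y - delta)%R, y] `|` S true l @^-1` `](y - delta)%R, y].
have mF l : measurable (F l) by apply: measurableU; exact: measurable_funPTI.
have sub : M j @^-1` `](y - delta)%R, y] `<=` \bigcup_(l in [set l | l != j]) F l.
  move=> w /=; rewrite in_itv/= => /andP[My yM].
  (* The hypothesis [delta <= y] prevents the base value 0 of the maximum from exceeding
     [y - delta]. *)
  have [l lj Hl] : exists2 l, l != j & y - delta < `|column_sum eps l w|.
    by move: My => /bigmax_gtP[|//]; rewrite subr_lt0 ltNge dy.
  exists l => //; rewrite /F /= /signed_sum !in_itv/= expr0 expr1 mul1r mulN1r.
  have yl := le_trans (le_rest_max eps w lj) yM.
  move: Hl yl; case: (ger0P (column_sum eps l w)) => _ Hl yl; [left|right];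
    by apply/andP.
apply: (le_trans (le_measure _ _ _ sub)); rewrite ?inE.
- exact: measurable_funPTI.
- by apply: fin_bigcup_measurable => //; exact: finite_finset.
apply: (le_trans (le_measure_bigcup_fin P (Q := fun l => l != j) (fun l _ => mF l))).
apply: (@le_trans _ _ (\sum_(l < d) (2 * kappa)%:E)%E); last first.
  by rewrite sumEFin sumr_const card_ord lee_fin [leRHS]mulr_natl.
apply: (@le_trans _ _ (\sum_(l < d | l != j) (2 * kappa)%:E)%E).
  apply: lee_sum => l _; apply: (le_trans (measureU2 _ _ _)); try exact: measurable_funPTI.
  by rewrite mulr_natl mulr2n EFinD; apply: leeD; exact: PE.
rewrite big_mkcond/=; apply: lee_sum => l _; case: ifP => // _.
by rewrite lee_fin mulr_ge0.
Qed.

(** Conditioning on the signed sum keeps the factor [q], the probability that it exceeds [x]. This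
    factor pays both for the union over [2 d] models and for the division by a selection probability
    of order [1/d]. *)
Lemma near_tie_le b j x delta kappa : 0 <= delta -> delta <= x -> column_law `[x, +oo[ = q%:E ->
  (forall y : R, x <= y -> (column_law `](y - delta)%R, y] <= kappa%:E)%E) ->
  (P [set w | [/\ x <= S b j w, S b j w - delta < M j w & M j w <= S b j w]]%R
    <= (q * (d%:R * (2 * kappa)))%:E)%E.
Proof.
move=> delta0 dx qx hk.
have k0 : 0 <= kappa.
  by rewrite -lee_fin; apply: le_trans (hk x (lexx x)); exact: column_law_ge0.
pose C : set (R * R) := [set z | x <= z.1] `&` ([set z | z.1 - delta < z.2] `&` [set z | z.2 <= z.1]).
have mC : measurable C.
  apply: measurableI; last apply: measurableI; rewrite -[X in measurable X]setTI.
  - by apply: (measurable_fun_ler (measurable_cst x) measurable_fst).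
  - apply: (measurable_fun_ltr _ measurable_snd) => //.
    exact: (measurable_funB measurable_fst (measurable_cst delta)).
  - by apply: (measurable_fun_ler measurable_snd measurable_fst).
have -> : [set w | [/\ x <= S b j w, S b j w - delta < M j w & M j w <= S b j w]] =
    (fun w => (S b j w, M j w)) @^-1` C.
  by apply/seteqP; split => w; [case=> h1 h2 h3; split|case=> h1 [h2 h3]; split].
rewrite (@independent_pair_law _ _ _ _ _ _ _ P (S b j) (M j)); last 2 first.
- exact: independent_signed_rest.
- exact: mC.
pose c := d%:R * (2 * kappa).
have c0 : 0 <= c by rewrite !mulr_ge0// ltW.
apply: (@le_trans _ _ (\int[distribution P (S b j)]_y (c%:E * (\1_(`[x, +oo[%classic : set R) y)%:E))%E).
  apply: ge0_le_integral => //.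
  - exact: (measurable_fun_xsection (distribution P (M j))).
  - by apply: measurable_funeM; apply/measurable_EFinP; exact: measurable_indic.
  move=> y _; rewrite indicE; have [xy|yx] := leP x y.
    rewrite mem_set ?mule1; last by rewrite /= in_itv/= andbT.
    have -> : xsection C y = `](y - delta)%R, y]%classic.
      apply/seteqP; split => z; rewrite /xsection /C/= inE/= in_itv/=.
        by move=> [_ [-> ->]].
      by move=> /andP[].
    by apply: rest_max_interval_le => //; [exact: le_trans xy|exact: hk].
  rewrite (_ : xsection C y = set0) ?measure0 ?mule_ge0//.
  apply/seteqP; split => z; rewrite /xsection /C/= inE/= => -[].
  by rewrite leNgt yx.
rewrite ge0_integralZl//; last by apply/measurable_EFinP; exact: measurable_indic.
rewrite integral_indic// setIT.
have E : P (S b j @^-1` `[x, +oo[) = q%:E by rewrite (signed_sum_law heps hpi hm b j).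
by rewrite [leRHS]EFinM -E muleC.
Qed.

(* Compare the interval with its [L] disjoint translates to the right of [x]. *)
Lemma column_law_interval_le x delta h L : 0 <= delta -> 0 <= h ->
  L%:R * fine (column_law `](x - delta)%R, x]) <=
  expR ((h * (L%:R * delta) *+ 2 + (L%:R * delta) ^+ 2) / (m%:R *+ 2))
    * fine (column_law `[x, +oo[) + L%:R * (delta * expR (- h ^+ 2 / (m%:R *+ 2))).
Proof.
move=> de0 h0; set c := expR _; set r := _ * expR _.
have fnu (i : interval R) : column_law [set` i] \is a fin_num by exact: column_law_fin_num.
have m1 : 1 <= Num.sqrt m%:R :> R by rewrite -[leLHS]sqrtr1 ler_wsqrtr// ler1n.
have m0 : 0 < m%:R *+ 2 :> R by rewrite mulrn_wgt0// ltr0n.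
(* A shift by [k.+1] lengths lands on the [k]-th interval to the right of [x], counting from 0. Its
   cost is bounded by that of the longest shift, [L * delta], so that [c] is free of [k]. *)
have step k : (k < L)%N -> fine (column_law `](x - delta)%R, x]) <=
    c * fine (column_law `](x + k%:R * delta)%R, (x + k.+1%:R * delta)%R]) + r.
  move=> kL; have k0 : 0 <= k.+1%:R * delta by rewrite mulr_ge0.
  have := mixture_noise_sum_shift_le hpi m.-1 x m1 k0 h0 de0.
  rewrite -/(column_law _) -/(column_law _) sqr_sqrtr// -/r.
  have -> : x + k.+1%:R * delta - delta = x + k%:R * delta.
    by rewrite -natr1 mulrDl mul1r addrA addrK.
  rewrite -(fineK (fnu `](x - delta)%R, x])) -(fineK (fnu `](x + k%:R * delta)%R, (x + k.+1%:R * delta)%R])).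
  rewrite -EFinM -EFinD lee_fin => /le_trans; apply.
  rewrite lerD2r ler_wpM2r ?fine_ge0 ?column_law_ge0// ler_expR ler_pM2r ?invr_gt0//.
  have kL' : k.+1%:R * delta <= L%:R * delta by rewrite ler_wpM2r// ler_nat.
  rewrite lerD ?lerMn2r ?ler_wpM2l ?orbT//.
  by rewrite ler_sqr ?nnegrE// mulr_ge0.
have sum k : (k <= L)%N -> k%:R * fine (column_law `](x - delta)%R, x]) <=
    c * fine (column_law `]x, (x + k%:R * delta)%R]) + k%:R * r.
  elim: k => [|k IH] kL.
    by rewrite !mul0r addr0 mulr_ge0 ?expR_ge0 ?fine_ge0 ?column_law_ge0.
  have H := lerD (IH (ltnW kL)) (step k kL).
  have xk : x <= x + k%:R * delta by rewrite lerDl mulr_ge0.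
  have kk : x + k%:R * delta <= x + k.+1%:R * delta by rewrite lerD2l ler_wpM2r// ler_nat.
  have -> : `]x, (x + k.+1%:R * delta)%R]%classic =
      `]x, (x + k%:R * delta)%R] `|` `](x + k%:R * delta)%R, (x + k.+1%:R * delta)%R].
    by rewrite -itv_bndbnd_setU// bnd_simp.
  rewrite column_lawU//; last first.
    apply/seteqP; split => // y /=; rewrite !in_itv/= => -[/andP[_]].
    by rewrite leNgt => /negP yk /andP[].
  rewrite fineD//; move: H.
  move: (fine _) (fine _) (fine _) => f1 f2 f3.
  by rewrite -natr1 mulrDl mul1r => /le_trans; apply; rewrite mulrDr mulrDl mul1r addrACA.
apply: (le_trans (sum L (leqnn L))); rewrite lerD2r ler_wpM2l ?expR_ge0//.
rewrite fine_le//; apply: le_column_law => //.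
by move=> y /=; rewrite !in_itv/= andbT => /andP[/ltW].
Qed.

End extreme_columns.

(** * The truncated Gaussian statistic *)

Section order_statistics.
Context {R : realType}.
Local Notation ger := (fun a b : R => b <= a).

Lemma ger_total : total ger. Proof. by move=> a b; exact: le_total. Qed.
Lemma ger_trans : transitive ger. Proof. by move=> b a c ba cb; exact: le_trans cb ba. Qed.
Lemma ger_anti : antisymmetric ger. Proof. by move=> a b /andP[ba ab]; apply: le_anti; rewrite ab ba. Qed.

Lemma nth0_sort_ger (t : seq R) : (forall x, x \in t -> 0 <= x) ->
  nth 0 (sort ger t) 0 = \big[Num.max/0]_(x <- t) x.
Proof.
move=> t0; rewrite -(perm_big _ (permEl (perm_sort ger t))).
have := sort_sorted ger_total t.
have {t0} : forall x, x \in sort ger t -> 0 <= x by move=> x; rewrite mem_sort; exact: t0.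
case: (sort ger t) => [|a r] r0 /=; first by rewrite big_nil.
rewrite (path_sortedE ger_trans) => /andP[/allP ra _].
apply/eqP; rewrite eq_le; apply/andP; split.
  by rewrite big_cons le_max lexx.
rewrite big_cons ge_max lexx/= big_seq; elim/big_ind : _ => [|x z xa za|x].
- by rewrite r0 ?mem_head.
- by rewrite ge_max xa.
- exact: ra.
Qed.

Lemma sort_ger_cons (a : R) (t : seq R) : (forall x, x \in t -> x <= a) ->
  sort ger (a :: t) = a :: sort ger t.
Proof.
move=> ta; apply: (sorted_eq ger_trans ger_anti).
- exact: sort_sorted ger_total _.
- rewrite /= (path_sortedE ger_trans) sort_sorted ?andbT; last exact: ger_total.
  by apply/allP => x; rewrite mem_sort; exact: ta.
- by rewrite (permPl (permEl (perm_sort ger _))) perm_cons perm_sym; exact: permEl (perm_sort ger t).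
Qed.

End order_statistics.

Section statistic.
Context {R : realType} (m d : nat).
Implicit Types (y : 'M[R]_(m, d)) (j : 'I_d).

Lemma selects_W y j s : s = 1 \/ s = -1 -> selects y j s ->
  s * Ybar y j = W y j /\ (forall l, W y l <= W y j).
Proof.
move=> s1 sel.
have sY0 : 0 <= s * Ybar y j by apply: le_trans sel; rewrite bigmax_idl le_max lexx.
have E : s * Ybar y j = W y j.
  rewrite /W -[LHS]ger0_norm// normrM.
  by case: s1 => ->; rewrite ?normrN normr1 mul1r.
split=> // l; have [->//|lj] := eqVneq l j.
by rewrite -E; move: sel => /bigmax_leP[_]; exact.
Qed.

(** The selected column has a largest [W], so it can be sorted to the head, and [Word y 2] is the
    head of the sorted rest. For [d = 1] the default 0 of [nth] matches the empty maximum. *)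
Lemma Word_selects y j s : s = 1 \/ s = -1 -> selects y j s ->
  Word y 1 = s * Ybar y j /\ Word y 2 = \big[Num.max/0]_(l < d | l != j) `|Ybar y l|.
Proof.
move=> s1 /(selects_W s1)[-> Wj].
pose t := [seq W y l | l <- enum 'I_d & l != j].
have E : sort (fun a b : R => b <= a) [seq W y l | l <- enum 'I_d] =
    W y j :: sort (fun a b : R => b <= a) t.
  rewrite -sort_ger_cons; last by move=> x /mapP[l _ ->].
  apply/perm_sortP; [exact: ger_total|exact: ger_trans|exact: ger_anti|].
  rewrite -map_cons; apply: perm_map; apply: uniq_perm.
  - exact: enum_uniq.
  - by rewrite /= mem_filter eqxx/= filter_uniq// enum_uniq.
  - by move=> l; rewrite inE mem_filter mem_enum; case: eqVneq.
rewrite /Word E/=; split => //.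
rewrite nth0_sort_ger; last by move=> x /mapP[l _ ->]; exact: normr_ge0.
by rewrite big_map big_filter big_enum_cond.
Qed.

Lemma bigmaxrM (c : R) (Q : pred 'I_d) (f : 'I_d -> R) : 0 <= c ->
  \big[Num.max/0]_(l < d | Q l) (c * f l) = c * \big[Num.max/0]_(l < d | Q l) f l.
Proof.
move=> c0; rewrite (big_morph ( *%R c) (id1 := 0) (op1 := Num.max))//; last exact: mulr0.
by move=> a b /=; rewrite maxr_pMr.
Qed.

Lemma TG_selects y j s : s = 1 \/ s = -1 -> selects y j s -> TG y = TG_selected j s y.
Proof.
move=> s1 sel; have [W1 W2] := Word_selects s1 sel.
by rewrite /TG /TG_selected W1 W2 bigmaxrM.
Qed.

Lemma selects_exists y : (0 < d)%N -> exists (b : bool) j, selects y j ((-1) ^+ b).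
Proof.
case: d y => // d' y _.
pose j := [arg max_(l > ord0 : 'I_d'.+1) `|Ybar y l|]%O.
have jmax l : `|Ybar y l| <= `|Ybar y j|.
  by rewrite /j; case: arg_maxP => // i _ /(_ l isT).
exists (Ybar y j < 0), j.
rewrite /selects -normrEsign; apply/bigmax_leP; split => //.
Qed.

End statistic.

Lemma Phi_nondecreasing (R : realType) : {homo @Phi R : u v / u <= v}.
Proof.
move=> u v uv; rewrite /Phi fine_le//; try exact: fin_num_measure.
by apply: le_measure; rewrite ?inE//; exact: subitvPr.
Qed.

Lemma one_sub_Phi_ratio_le (R : realType) (u v : R) : 0 <= u -> u <= v ->
  (1 - Phi v) / (1 - Phi u) <= expR (- (v ^+ 2 - u ^+ 2) / 2).
Proof.
(* If the denominator is 0, so is the ratio, by the convention on inverses. *)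
move=> u0 uv; have := one_sub_Phi_ge0 u; rewrite le_eqVlt => /predU1P[<-|p0].
  by rewrite invr0 mulr0 expR_ge0.
by rewrite ler_pdivrMr// one_sub_Phi_le.
Qed.

Section statistic_of_errors.
Context disp (T : measurableType disp) (R : realType) (P : probability T R) (m d : nat).
Variable eps : 'I_m -> 'I_d -> {RV P >-> R}.
Variable mu : 'I_d -> R.
Hypothesis mu0 : forall j, mu j = 0.
Hypothesis hm : (0 < m)%N.
Local Notation S := (signed_sum eps).
Local Notation M := (rest_max eps).
Local Notation Y := (observations mu eps).
Local Notation B := (mix_shift R m d).

Let m0 : 0 < m%:R :> R. Proof. by rewrite ltr0n. Qed.

Lemma Ybar_observations w j : Ybar (Y w) j = m%:R^-1 * column_sum eps j w.
Proof.
by rewrite /Ybar; congr (_ * _); apply: eq_bigr => i _; rewrite mxE mu0 add0r.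
Qed.

Lemma bigmax_Ybar w j c : 0 <= c ->
  \big[Num.max/0]_(l < d | l != j) (c * `|Ybar (Y w) l|) = c / m%:R * M j w.
Proof.
move=> c0; rewrite /rest_max -bigmaxrM ?divr_ge0//.
by apply: eq_bigr => l _; rewrite Ybar_observations normrM mulrA ger0_norm.
Qed.

Lemma selects_observations w j (b : bool) : selects (Y w) j ((-1) ^+ b) <-> M j w <= S b j w.
Proof.
rewrite /selects.
have -> : \big[Num.max/0]_(l < d | l != j) `|Ybar (Y w) l| = m%:R^-1 * M j w.
  by rewrite -[m%:R^-1]mul1r -bigmax_Ybar//; apply: eq_bigr => l _; rewrite mul1r.
rewrite Ybar_observations mulrCA ler_pM2l ?invr_gt0//.
Qed.

(** The factor that turns a column sum into the argument of [Phi]. *)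
Definition gauss_scale : R := Num.sqrt m%:R / m%:R / Num.sqrt 2.

Lemma gauss_scale_gt0 : 0 < gauss_scale.
Proof. by rewrite !divr_gt0// sqrtr_gt0. Qed.

Lemma gauss_scale_sqr : gauss_scale ^+ 2 = (m%:R *+ 2)^-1.
Proof.
rewrite /gauss_scale !exprMn !exprVn !sqr_sqrtr// ?ltW//; field.
by rewrite gt_eqF.
Qed.

Lemma TG_selected_observations w j (b : bool) :
  TG_selected j ((-1) ^+ b) (Y w) =
  (1 - Phi (gauss_scale * S b j w)) / (1 - Phi (gauss_scale * M j w)).
Proof.
rewrite /TG_selected bigmax_Ybar ?sqrtr_ge0// Ybar_observations.
by congr ((1 - Phi _) / (1 - Phi _)); rewrite /gauss_scale /signed_sum; ring.
Qed.

Lemma measurable_TG_selected j (b : bool) :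
  measurable_fun setT (fun w => TG_selected j ((-1) ^+ b) (Y w)).
Proof.
under eq_fun do rewrite TG_selected_observations.
have mPhi (f : T -> R) : measurable_fun setT f ->
    measurable_fun setT (fun w => 1 - Phi (gauss_scale * f w)).
  move=> mf; apply: measurable_funB => //.
  apply: (@measurableT_comp _ _ _ _ _ _ (@Phi R)); last exact: measurable_funM.
  by apply: nondecreasing_measurable => //; exact: Phi_nondecreasing.
apply: measurable_funM; first by apply: mPhi; exact: measurable_signed_sum.
(* The inverse is rewritten as a real power, which is a measurable function on the whole line. *)
under eq_fun do rewrite -powR_inv1 ?one_sub_Phi_ge0//.
apply: (@measurableT_comp _ _ _ _ _ _ (fun x : R => x `^ (-1))).
  exact: measurable_powR.
by apply: mPhi; exact: measurable_rest_max.
Qed.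

(* The statistic is at most [expR (- (S ^+ 2 - M ^+ 2) / (4 * m))]; as [m * B <= S], a gap
   [S - M] of order [1 / B] makes this exponent large. *)
Lemma TG_selected_near_tie w j (b : bool) e : 0 < B -> m%:R * B <= S b j w -> M j w <= S b j w ->
  0 < e -> e < TG_selected j ((-1) ^+ b) (Y w) ->
  S b j w - (4 * `|ln e| + 1) / B < M j w.
Proof.
move=> B0 BS MS e0; rewrite TG_selected_observations => eT.
have g0 := gauss_scale_gt0.
have M0 := rest_max_ge0 eps j w.
have := lt_le_trans eT (one_sub_Phi_ratio_le (mulr_ge0 (ltW g0) M0) (ler_wpM2l (ltW g0) MS)).
have g2 := gauss_scale_sqr.
rewrite -[X in X < _](lnK (x := e)) ?posrE// ltr_expR.
move: BS MS M0 g0 g2; move: (S b j w) (M j w) gauss_scale => s z g BS MS M0 g0 g2 H.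
have H2 : (s - z) * (s + z) < 4 * m%:R * `|ln e|.
  have H3 : g ^+ 2 * ((s - z) * (s + z)) / 2 < `|ln e|.
    have : - ln e <= `|ln e| by rewrite -normrN ler_norm.
    apply: lt_le_trans; rewrite ltrNr; apply: (lt_le_trans H).
    by rewrite le_eqVlt; apply/orP; left; apply/eqP; field.
  move: H3; rewrite g2 ltr_pdivrMr// ltr_pdivrMl ?mulrn_wgt0//.
  by move=> /lt_le_trans; apply; rewrite le_eqVlt; apply/orP; left; apply/eqP; ring.
(* With a gap of at least [A / B], [A = 4 |ln e| + 1], the product [(s - z) (s + z)] is at least
   [A m]; the [+ 1] in [A] is the surplus [m] that contradicts [H2]. *)
rewrite ltNge; apply/negP => H4.
have H5 : (4 * `|ln e| + 1) / B <= s - z by lra.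
have BSz : m%:R * B <= s + z by lra.
have : (4 * `|ln e| + 1) / B * (m%:R * B) <= (s - z) * (s + z).
  by rewrite ler_pM// ?divr_ge0 ?mulr_ge0 ?ltW// addr_ge0 ?mulr_ge0.
have -> : (4 * `|ln e| + 1) / B * (m%:R * B) = 4 * m%:R * `|ln e| + m%:R.
  by field; rewrite gt_eqF.
by move=> /le_lt_trans /(_ H2); rewrite gtrDl ltNge ltW.
Qed.

End statistic_of_errors.

(** * Asymptotics *)

Section asymptotics.
Context {R : realType}.

Lemma mix_shift_sqr (m d : nat) : (0 < d)%N ->
  mix_shift R m d ^+ 2 = expR (ln d%:R / m%:R) / 2.
Proof.
move=> d0; rewrite sqr_sqrtr ?divr_ge0 ?powR_ge0//.
by rewrite /powR pnatr_eq0 gtn_eqF//= [_^-1 * ln _]mulrC.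
Qed.

(* [L] is chosen to absorb the factor [expR 2] that bounds the translation cost; then
   [B ^+ 2 = expR v / 2] with [v = ln d / m], so the Gaussian term is at most
   [expR (m * (v - c * expR v))] for some [c > 0], which beats [1 / d] for large [v]. *)
Lemma near_tie_numeric (A e : R) : 0 < A -> 0 < e -> exists (L : nat) (V : R),
  (0 < L)%N /\ forall m d : nat, (0 < m)%N -> (0 < d)%N -> V <= ln d%:R / m%:R ->
  let B := mix_shift R m d in
  let h := m%:R * B / (L%:R * A) in
  [/\ 0 < B, A / B <= m%:R * B &
    expR ((h * (L%:R * (A / B)) *+ 2 + (L%:R * (A / B)) ^+ 2) / (m%:R *+ 2)) * (2 * d%:R)^-1
      + L%:R * (A / B * expR (- h ^+ 2 / (m%:R *+ 2))) <= L%:R * (e / (2 * d%:R))].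
Proof.
move=> A0 e0.
pose L := (Num.truncn (2 * expR 2 / e)).+1.
have L0 : 0 < L%:R :> R by rewrite ltr0n.
have Le : 2 * expR 2 / e <= L%:R by rewrite ltW// truncnS_gt.
pose eta2 : R := ((L%:R * A) ^+ 2)^-1.
have eta0 : 0 < eta2 by rewrite invr_gt0 exprn_gt0// mulr_gt0.
(* Each summand is a separate lower bound on [v]. In order, they give [1 + A <= B], the smallness of
   the squared total shift, the dominance of the double exponential, and [exp (- v) <= e / 4]. *)
pose V := 2 * (1 + A) ^+ 2 + (L%:R * A) ^+ 2 + 16 / eta2 + 4 / e.
exists L, V; split => // m d m0' d0' hV.
set v := ln _ / _ in hV; move=> B h.
have m0 : 0 < m%:R :> R by rewrite ltr0n.
have m1 : 1 <= m%:R :> R by rewrite ler1n.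
have d0 : 0 < d%:R :> R by rewrite ltr0n.
have B2 : B ^+ 2 = expR v / 2 by exact: mix_shift_sqr.
have a1 : 0 <= 2 * (1 + A) ^+ 2 by rewrite mulr_ge0// exprn_ge0// addr_ge0// ltW.
have a2 : 0 <= (L%:R * A) ^+ 2 by rewrite exprn_ge0// mulr_ge0// ltW.
have a3 : 0 <= 16 / eta2 by rewrite divr_ge0// ltW.
have a4 : 0 <= 4 / e by rewrite divr_ge0// ltW.
have V1 : 2 * (1 + A) ^+ 2 <= v by rewrite /V in hV; lra.
have V2 : (L%:R * A) ^+ 2 <= v by rewrite /V in hV; lra.
have V3 : 16 / eta2 <= v by rewrite /V in hV; lra.
have V4 : 4 / e <= v by rewrite /V in hV; lra.
have v0 : 0 <= v by exact: le_trans V4.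
have vK : v <= expR v by have := expR_ge1Dx v; lra.
have BA : 1 + A <= B.
  rewrite -ler_sqr ?nnegrE ?addr_ge0 ?sqrtr_ge0 ?(ltW A0)// B2; lra.
have B0 : 0 < B by lra.
have AB1 : A / B <= 1 by rewrite ler_pdivrMr// mul1r; lra.
have mB : 1 <= m%:R * B by rewrite mulr_ege1//; lra.
split=> //; first exact: le_trans mB.
have LA0 : 0 < L%:R * A by rewrite mulr_gt0.
(* [h] is chosen so that [h] times the total shift [L A / B] equals [m]: the cross term contributes
   exactly 1 to the exponent and the square at most 1. *)
have c2 : (h * (L%:R * (A / B)) *+ 2 + (L%:R * (A / B)) ^+ 2) / (m%:R *+ 2) <= 2.
  have -> : h * (L%:R * (A / B)) = m%:R by rewrite /h; field; rewrite !gt_eqF.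
  rewrite ler_pdivrMr ?mulrn_wgt0//.
  have : (L%:R * (A / B)) ^+ 2 <= m%:R *+ 2.
    rewrite mulrA expr_div_n B2 ler_pdivrMr ?divr_gt0 ?expR_gt0//.
    have : expR v <= m%:R * expR v by rewrite ler_peMl ?expR_ge0.
    lra.
  lra.
have r1 : d%:R * expR (- h ^+ 2 / (m%:R *+ 2)) <= e / 4.
  have -> : d%:R * expR (- h ^+ 2 / (m%:R *+ 2)) = expR (m%:R * (v - expR v * eta2 / 4)).
    rewrite -[X in X * _](lnK (x := d%:R)) ?posrE// -expRD; congr expR.
    have -> : h ^+ 2 = m%:R ^+ 2 * (expR v / 2) * eta2.
      by rewrite -B2 /eta2 /h expr_div_n exprMn.
    have -> : ln d%:R = m%:R * v by rewrite /v mulrCA divff ?mulr1// gt_eqF.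
    by field; rewrite gt_eqF.
  have H1 : v ^+ 2 / 2 <= expR v.
    by have := @expR_ge1Dxn R v 1%N v0; rewrite (_ : 2`! = 2)//; lra.
  have H2 : 16 <= v * eta2 by rewrite -ler_pdivrMr.
  (* Since [exp v >= v^2 / 2] and [v eta2 >= 16], the subtracted term is at least [2 v]. *)
  have H3 : v - expR v * eta2 / 4 <= - v.
    have : v ^+ 2 / 2 * eta2 <= expR v * eta2 by rewrite ler_pM2r.
    have : 16 * v <= v * eta2 * v by rewrite ler_wpM2r.
    have -> : v ^+ 2 / 2 * eta2 = v * eta2 * v / 2 by field.
    lra.
  apply: (@le_trans _ _ (expR (- v))).
    rewrite ler_expR; apply: (@le_trans _ _ (m%:R * - v)); first by rewrite ler_pM2l.
    by rewrite mulrN lerN2 ler_peMl.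
  rewrite expRN -(invrK (e / 4)) lef_pV2 ?posrE ?invr_gt0 ?divr_gt0 ?expR_gt0//.
  by rewrite invf_div; exact: le_trans vK.
have -> : L%:R * (e / (2 * d%:R)) = L%:R * e / 2 * (2 * d%:R)^-1 + L%:R * (e / 4 / d%:R).
  by field; rewrite gt_eqF.
apply: lerD.
  rewrite ler_wpM2r ?invr_ge0 ?mulr_ge0//.
  apply: (@le_trans _ _ (expR 2)); first by rewrite ler_expR.
  by move: Le; rewrite ler_pdivrMr//; lra.
rewrite ler_pM2l// ler_pdivlMr//.
rewrite [leLHS](_ : _ = A / B * (d%:R * expR (- h ^+ 2 / (m%:R *+ 2)))); last by ring.
apply: le_trans r1; rewrite ler_piMl// mulr_ge0 ?expR_ge0//.
Qed.
End asymptotics.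

Section rejection.
Context {R : realType}.

Lemma mix_variance (m d : nat) : (0 < d)%N ->
  1 + 2 * mix_weight R m d * mix_shift R m d ^+ 2 = 2.
Proof.
move=> d0; rewrite mix_shift_sqr//.
have -> : mix_weight R m d = expR (- (ln d%:R / m%:R)).
  by rewrite /mix_weight /powR invr_eq0 pnatr_eq0 gtn_eqF//= lnV ?posrE ?ltr0n// mulrN mulrC.
by rewrite expRN; field; rewrite gt_eqF// expR_gt0.
Qed.

(** [V] is fixed before the probability space and the model: it depends on [e] and [e'] only, so
    that along the sequence one index bound serves all [b] and [j] at once. *)
Lemma selected_extreme_le (e e' : R) : 0 < e -> 0 < e' -> exists V : R,
  forall disp (T : measurableType disp) (P : probability T R) (m d : nat)
    (mu : 'I_d -> R) (eps : 'I_m -> 'I_d -> {RV P >-> R}),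
  iid_errors eps -> 2 * mix_weight R m d <= 1 -> (0 < m)%N -> (forall j, mu j = 0) ->
  V <= ln d%:R / m%:R ->
  forall b j x, m%:R * mix_shift R m d <= x -> column_law m d `[x, +oo[ = ((2 * d%:R)^-1)%:E ->
  (P [set w | [/\ x <= signed_sum eps b j w, rest_max eps j w <= signed_sum eps b j w
     & e < TG_selected j ((-1) ^+ b) (observations mu eps w)]]%R <= ((2 * d%:R)^-1 * e')%:E)%E.
Proof.
move=> e0 e'0; have A0 : 0 < 4 * `|ln e| + 1 :> R by rewrite ltr_wpDl// mulr_ge0.
have [L [V [L0 HV]]] := near_tie_numeric A0 e'0.
exists V => disp T P m d mu eps heps hpi hm mu0 Vd b j x Bx qx.
have d0 : (0 < d)%N by rewrite (leq_ltn_trans _ (ltn_ord j)).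
have [B0 AB H] := HV m d hm d0 Vd.
set A := 4 * _ + 1 in A0 HV AB H; set h := m%:R * _ / _ in H.
have dR0 : 0 < d%:R :> R by rewrite ltr0n.
have LR0 : 0 < L%:R :> R by rewrite ltr0n.
have AB0 : 0 <= A / mix_shift R m d by rewrite divr_ge0// ltW.
have h0 : 0 <= h by rewrite !(mulr_ge0, invr_ge0)// ltW.
(* The mass [e' / (2 d)] per interval is what turns the bound of [near_tie_le] into [q * e']. For
   [y] beyond [x], the tail at [y] is at most the tail [q] at [x]. *)
have hk y : x <= y -> (column_law m d `](y - A / mix_shift R m d)%R, y] <= (e' / (2 * d%:R))%:E)%E.
  move=> xy; rewrite -(fineK (column_law_fin_num heps hpi hm j _))// lee_fin.
  rewrite -(ler_pM2l LR0); apply: le_trans (column_law_interval_le heps hpi hm j y L AB0 h0) (le_trans _ H).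
  rewrite lerD2r ler_wpM2l ?expR_ge0//.
  rewrite -lee_fin (fineK (column_law_fin_num heps hpi hm j _))// -qx.
  apply: (le_column_law heps hpi hm j) => // z /=; rewrite !in_itv/= !andbT.
  exact: le_trans.
have -> : (2 * d%:R)^-1 * e' = (2 * d%:R)^-1 * (d%:R * (2 * (e' / (2 * d%:R)))).
  by field; rewrite gt_eqF.
apply: le_trans (near_tie_le heps hpi hm j b j AB0 (le_trans AB Bx) qx hk).
have mS := measurable_signed_sum eps b j.
have mM := measurable_rest_max eps j.
apply: le_measure; rewrite ?inE.
- rewrite (_ : [set w | _] = [set w | x <= signed_sum eps b j w] `&`
    ([set w | rest_max eps j w <= signed_sum eps b j w] `&`
     [set w | e < TG_selected j ((-1) ^+ b) (observations mu eps w)])).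
    apply: measurableI; first exact: measurable_le_set.
    apply: measurableI; first exact: measurable_le_set.
    by apply: measurable_lt_set => //; exact: measurable_TG_selected.
  by apply/seteqP; split => w /=; [case|case=> ? []].
- rewrite (_ : [set w | _] = [set w | x <= signed_sum eps b j w] `&`
    ([set w | signed_sum eps b j w - A / mix_shift R m d < rest_max eps j w] `&`
     [set w | rest_max eps j w <= signed_sum eps b j w])).
    apply: measurableI; first exact: measurable_le_set.
    apply: measurableI; last exact: measurable_le_set.
    by apply: measurable_lt_set => //; exact: measurable_funB.
  by apply/seteqP; split => w /=; [case|case=> ? []].
move=> w [xS MS eT]; split => //.
exact: (TG_selected_near_tie mu0 hm B0 (le_trans Bx xS) MS e0 eT).
Qed.

End rejection.

(** * The unconditional statistic on extreme events *)

Section events.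
Context disp (T : measurableType disp) (R : realType) (P : probability T R) (m d : nat).
Variable eps : 'I_m -> 'I_d -> {RV P >-> R}.
Variable mu : 'I_d -> R.
Hypothesis heps : iid_errors eps.
Hypothesis hpi : 2 * mix_weight R m d <= 1.
Hypothesis hm : (0 < m)%N.
Hypothesis mu0 : forall j, mu j = 0.
Local Notation S := (signed_sum eps).
Local Notation M := (rest_max eps).
Local Notation Y := (observations mu eps).
Local Notation q := ((2 * d%:R)^-1 : R).

Lemma measurable_selected_gt (b : bool) j e :
  measurable [set w | e < TG_selected j ((-1) ^+ b) (Y w)].
Proof.
exact: (measurable_lt_set (measurable_cst e) (measurable_TG_selected eps mu0 j b)).
Qed.

(** Some model is always selected, and [TG] equals its conditional statistic. Ties merely make the
    pieces overlap, which neither measurability nor a union bound minds. *)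
Lemma TG_gtE e : (0 < d)%N -> [set w | e < TG (Y w)] =
  \bigcup_(bj : bool * 'I_d) ([set w | M bj.2 w <= S bj.1 bj.2 w] `&`
     [set w | e < TG_selected bj.2 ((-1) ^+ bj.1) (Y w)]).
Proof.
move=> d0; have s1 (b : bool) : (-1 : R) ^+ b = 1 \/ (-1 : R) ^+ b = -1.
  by case: b; [right|left]; rewrite ?expr1 ?expr0.
apply/seteqP; split => w /=.
  have [b [j sel]] := selects_exists (Y w) d0.
  rewrite (TG_selects (s1 b) sel) => eT; exists (b, j) => //.
  by split => //; exact/(selects_observations eps mu0 hm).
by move=> [[b j] _ [/(selects_observations eps mu0 hm) sel]] /=; rewrite (TG_selects (s1 b) sel).
Qed.

Lemma measurable_TG_gt e : (0 < d)%N -> measurable [set w | e < TG (Y w)].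
Proof.
move=> d0; rewrite TG_gtE//; apply: fin_bigcup_measurable; first exact: finite_finset.
move=> [b j] _; apply: measurableI; last exact: measurable_selected_gt.
exact: measurable_selection.
Qed.

Definition some_extreme (x : R) : set T :=
  ~` \bigcap_j (column_sum eps j @^-1` [set y | `|y| <= x]).

Let measurable_none_extreme (x : R) :
  measurable (\bigcap_j (column_sum eps j @^-1` [set y | `|y| <= x])).
Proof.
apply: fin_bigcap_measurable; first exact: finite_finset.
move=> j _; rewrite -[X in measurable X]setTI; apply: (measurable_column_sum eps j) => //.
exact: measurable_abs_le.
Qed.

Lemma measurable_some_extreme x : measurable (some_extreme x).
Proof. exact: measurableC. Qed.

(** The bound [(1 - 1/d)^d <= 1/e] gives at least [1 - 1/e], and this is at least [1/e] because
    [e >= 2]. *)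
Lemma some_extreme_ge x : (0 < d)%N -> 0 <= x -> column_law m d `[x, +oo[ = q%:E ->
  ((expR (-1))%:E <= P (some_extreme x))%E.
Proof.
move=> d0 x0 qx; pose j0 := Ordinal d0.
have dR0 : 0 < d%:R :> R by rewrite ltr0n.
have mx := measurable_abs_le x.
have lawj j : P (column_sum eps j @^-1` [set y | `|y| <= x]) = (1 - d%:R^-1)%:E.
  rewrite -(column_law_abs_le heps hpi hm j0 x0 qx) fineK ?(column_law_fin_num heps hpi hm j0)//.
  exact: column_sum_law.
have PN : P (\bigcap_j (column_sum eps j @^-1` [set y | `|y| <= x])) = ((1 - d%:R^-1) ^+ d)%:E.
  rewrite (independent_columns heps)//.
  under eq_bigr => j _ do rewrite lawj.
  by rewrite prodEFin prodr_const card_ord.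
rewrite /some_extreme probability_setC// PN -EFinB lee_fin.
have H1 : (1 - d%:R^-1) ^+ d <= expR (-1) :> R.
  have -> : expR (-1) = expR (- d%:R^-1) ^+ d :> R.
    by rewrite -expRM_natl mulrN mulfV// gt_eqF.
  rewrite lerXn2r ?nnegrE ?expR_ge0//; last exact: expR_ge1Dx.
  by rewrite subr_ge0 invf_le1// ler1n.
have H2 : expR (-1) <= 2^-1 :> R.
  by rewrite expRN lef_pV2 ?posrE ?expR_gt0// (le_trans _ (expR_ge1Dx 1))//; lra.
by have : expR (-1) + expR (-1) <= 1 :> R; lra.
Qed.

(** The selected signed sum is the largest modulus among the columns, so on [some_extreme] it
    reaches [x] itself. The [2 d] models cost [q * e'] each, and [2 d q = 1]. *)
Lemma some_extreme_TG_gt_le x e e' : (0 < d)%N ->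
  (forall (b : bool) j, (P [set w | [/\ x <= S b j w, M j w <= S b j w &
     e < TG_selected j ((-1) ^+ b) (Y w)]]%R <= (q * e')%:E)%E) ->
  (P (some_extreme x `&` [set w | (e < TG (Y w))%R]) <= e'%:E)%E.
Proof.
move=> d0 H; pose G (bj : bool * 'I_d) := [set w | x <= S bj.1 bj.2 w] `&`
  ([set w | M bj.2 w <= S bj.1 bj.2 w] `&` [set w | e < TG_selected bj.2 ((-1) ^+ bj.1) (Y w)]).
have mG bj : measurable (G bj).
  apply: measurableI; first by apply: measurable_le_set => //; exact: measurable_signed_sum.
  by apply: measurableI; [exact: measurable_selection|exact: measurable_selected_gt].
have PG bj : (P (G bj) <= (q * e')%:E)%E.
  have := H bj.1 bj.2; congr (P _ <= _)%E.
  by apply/seteqP; split => w /=; [case|case=> ? []].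
apply: (@le_trans _ _ (P (\bigcup_(bj in [set bj | predT bj]) G bj))).
  apply: le_measure; rewrite ?inE.
  - by apply: measurableI; [exact: measurable_some_extreme|exact: measurable_TG_gt].
  - by apply: fin_bigcup_measurable => //; exact: finite_finset.
  rewrite TG_gtE// => w [Ew [[b j] _ [/= MS eT]]]; exists (b, j) => //; split => //=.
  rewrite leNgt; apply/negP => Sx; apply: Ew => l _ /=.
  have [<-|lj] := eqVneq j l.
    rewrite (le_trans _ (ltW Sx))// -(ger0_norm (le_trans (rest_max_ge0 eps j w) MS)).
    by rewrite normrM normr_sign mul1r.
  by rewrite (le_trans (le_rest_max eps w _) (le_trans MS (ltW Sx)))// eq_sym.
apply: le_trans (le_measure_bigcup_fin P _) _ => //.
apply: (le_trans (lee_sum _ (fun bj _ => PG bj))).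
rewrite sumEFin lee_fin sumr_const card_prod card_bool card_ord -[_ *+ (2 * d)]mulr_natl natrM.
by rewrite mulrA mulfV ?mul1r// mulf_neq0// pnatr_eq0 -lt0n.
Qed.

End events.

(** * Limits along the sequence and the contradiction with uniformity *)

Section limits.
Context {R : realType}.

Lemma limn_einf_ge (u : nat -> \bar R) l : (forall n, l <= u n)%E -> (l <= limn_einf u)%E.
Proof.
move=> lu; rewrite limn_einf_lim; apply: lime_ge; first exact: is_cvg_einfs.
by apply: nearW => n; apply: le_ereal_inf_tmp => _ [k _ <-].
Qed.

Lemma ge0_cvge0 (u : nat -> \bar R) : (forall n, 0 <= u n)%E ->
  (forall e : R, 0 < e -> \forall n \near \oo, (u n <= e%:E)%E) -> u n @[n --> \oo] --> 0%E.
Proof.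
move=> u0 ue; have ufin e n : (u n <= e%:E)%E -> u n \is a fin_num.
  by move=> H; rewrite ge0_fin_numE// (le_lt_trans H)// ltry.
apply/fine_cvgP; split.
  by apply: filterS (ue 1 ltr01) => n; exact: ufin.
apply/cvgr0Pnorm_le => e e0; apply: filterS (ue e e0) => n H.
by rewrite /= ger0_norm ?fine_ge0// -lee_fin fineK// (ufin e).
Qed.

Lemma unif01_itvNyc (x : R) : 0 < x -> x < 1 -> unif01 [set` `]-oo, x]] = x%:E.
Proof.
move=> x0 x1; rewrite /unif01 /uniform_prob integral_uniform_pdf.
have -> : `]-oo, x]%classic `&` `[0%R, 1%R] = `[0%R, x]%classic.
  apply/seteqP; split => y /=; rewrite !in_itv/=; first by move=> [-> /andP[->]].
  by move=> /andP[-> yx]; rewrite yx (le_trans yx (ltW x1)).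
rewrite (eq_integral (fun=> 1%E)).
  by rewrite integral_cst//= mul1e lebesgue_measure_itv/= lte_fin x0 sube0.
move=> y; rewrite inE/= in_itv/= => /andP[y0 yx].
by rewrite /uniform_pdf y0 (le_trans yx (ltW x1)) subr0 invr1.
Qed.

Lemma unif01_continuous (x : R) : 0 < x -> x < 1 ->
  {for x, continuous (fun t : R => unif01 [set` `]-oo, t]])}.
Proof.
move=> x0 x1; rewrite /prop_for /continuous_at unif01_itvNyc//.
have cE : t%:E @[t --> x] --> x%:E.
  by apply/fine_cvgP; split; [exact: nearW|exact: cvg_id].
apply: cvg_trans cE.
apply: near_eq_cvg; near=> t; rewrite unif01_itvNyc//; near: t.
- exact: lt_nbhsr.
- exact: lt_nbhsl.
Unshelve. all: by end_near.
Qed.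

(** At [p / 2] a uniform limit would give [p <= p / 2 + 0] by splitting [E n] according to whether
    [X n] exceeds [p / 2]. The splitting is a hypothesis because [Q n] is a bare set function, so
    that [cond_prob] is covered. *)
Lemma vanishing_on_event (disp : nat -> measure_display)
    (T : forall n, measurableType (disp n)) (Q : forall n, set (T n) -> \bar R)
    (X : forall n, T n -> R) (p : R) (E : forall n, set (T n)) :
  0 < p -> p <= 1 ->
  (forall n A, 0 <= Q n A)%E ->
  (forall n x, Q n (E n) <= Q n [set w | (X n w <= x)%R] + Q n (E n `&` [set w | (x < X n w)%R]))%E ->
  (forall n, measurable (E n)) ->
  (forall n, p%:E <= Q n (E n))%E ->
  (forall e e' : R, 0 < e -> 0 < e' ->
    \forall n \near \oo, (Q n (E n `&` [set w | (e < X n w)%R]) <= e'%:E)%E) ->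
  ~ cvg_in_distribution Q X (@unif01 R) /\ cvg0_on_event Q X p.
Proof.
move=> p0 p1 Q0 Qsub mE pE QE.
have Qcvg e : 0 < e -> Q n (E n `&` [set w | e < X n w]) @[n --> \oo] --> 0%E.
  by move=> e0; apply: ge0_cvge0 => // e' e'0; exact: QE.
split; last by exists E; split => //; exact: limn_einf_ge.
have p20 : 0 < p / 2 by rewrite divr_gt0.
have p21 : p / 2 < 1 by lra.
move=> /(_ (p / 2) (unif01_continuous p20 p21)); rewrite unif01_itvNyc// => H.
have : (p%:E <= (p / 2)%:E + 0)%E.
  apply: (@cvge_ge nat \oo _ R (fun n => Q n [set w | (X n w <= p / 2)%R] +
    Q n (E n `&` [set w | (p / 2 < X n w)%R]))%E).
    by apply: nearW => n; exact: le_trans (pE n) (Qsub n _).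
  by apply: cvgeD => //; exact: Qcvg.
by rewrite adde0 lee_fin; lra.
Qed.

End limits.

(** Both estimates of the selection probability enter: the upper bound [q] in the first clause, the
    lower bound [q / e] in the third, where it costs the factor [expR 1]. The second clause is
    subadditivity on the selection event. *)
Lemma TG_selected_conditional disp (T : measurableType disp) (R : realType)
    (P : probability T R) (m d : nat) (mu : 'I_d -> R)
    (eps : 'I_m -> 'I_d -> {RV P >-> R}) (b : bool) (j : 'I_d) (x : R) :
  iid_errors eps -> 2 * mix_weight R m d <= 1 -> (0 < m)%N -> (forall j, mu j = 0) ->
  0 <= x -> column_law m d `[x, +oo[ = ((2 * d%:R)^-1)%:E ->
  let Y := observations mu eps in
  let s : R := (-1) ^+ b in
  let Q := cond_prob P [set w | selects (Y w) j s] in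
  let X w := TG_selected j s (Y w) in
  let E := [set w | x <= signed_sum eps b j w] in
  [/\ ((expR (-1))%:E <= Q E)%E,
    (forall y, Q E <= Q [set w | (X w <= y)%R] + Q (E `&` [set w | (y < X w)%R]))%E &
    forall e e' : R,
      (P [set w | [/\ x <= signed_sum eps b j w, rest_max eps j w <= signed_sum eps b j w
        & e < X w]]%R <= ((2 * d%:R)^-1 * e')%:E)%E ->
      (Q (E `&` [set w | (e < X w)%R]) <= (expR 1 * e')%:E)%E].
Proof.
move=> heps hpi hm mu0 x0 qx Y s Q X E.
set q := (2 * d%:R)^-1 in qx *.
have dR0 : 0 < d%:R :> R by rewrite ltr0n (leq_ltn_trans _ (ltn_ord j)).
have q0 : 0 < q by rewrite invr_gt0 mulr_gt0.
pose M := [set w | rest_max eps j w <= signed_sum eps b j w].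
have ME : [set w | selects (Y w) j s] = M.
  by apply/seteqP; split => w /= /(selects_observations eps mu0 hm).
have mM : measurable M by exact: measurable_selection.
have mE : measurable E by apply: measurable_le_set => //; exact: measurable_signed_sum.
have mX y : measurable [set w | y < X w] by exact: measurable_selected_gt.
have mXle y : measurable [set w | X w <= y].
  have -> : [set w | X w <= y] = ~` [set w | y < X w].
    by apply/seteqP; split => w /=; rewrite leNgt => /negP.
  exact: measurableC.
have PM : fine (P M) <= q.
  rewrite -lee_fin fineK; first exact: selection_prob_le.
  exact: fin_num_measure.
have fP A : measurable A -> P A \is a fin_num by move=> mA; exact: fin_num_measure.
have PEM : expR (-1) * q <= fine (P (E `&` M)).
  rewrite -lee_fin fineK; last by apply: fP; exact: measurableI.
  exact: (selected_extreme_ge heps hpi hm j b j x0 qx).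
have PMge : expR (-1) * q <= fine (P M).
  apply: (le_trans PEM); apply: fine_le; [exact/fP/measurableI|exact: fP|].
  by apply: le_measure; rewrite ?inE//; exact: measurableI.
have PM0 : 0 < fine (P M) by rewrite (lt_le_trans _ PMge)// mulr_gt0 ?expR_gt0.
have QE A : Q A = (fine (P (A `&` M)) / fine (P M))%:E by rewrite /Q ME.
split.
- rewrite QE lee_fin ler_pdivlMr// (le_trans _ PEM)// ler_wpM2l ?expR_ge0//.
- move=> y; rewrite !QE -EFinD lee_fin -mulrDl ler_pM2r ?invr_gt0//.
  have mI A B : measurable A -> measurable B -> measurable (A `&` B) := @measurableI _ _ A B.
  rewrite -fineD; [|exact/fP/mI|exact/fP/mI/mM/mI].
  have mU : measurable (([set w | X w <= y] `&` M) `|` (E `&` [set w | y < X w] `&` M)).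
    by apply: measurableU; [exact: mI|exact/mI/mM/mI].
  apply: fine_le; [exact/fP/mI| |].
    by rewrite fin_numD !fP//; do ?[exact: mI|exact/mI/mM/mI].
  apply: (@le_trans _ _ (P (([set w | X w <= y] `&` M) `|` (E `&` [set w | y < X w] `&` M)))).
    apply: le_measure; rewrite ?inE//; first exact: mI.
    by move=> w [Ew Mw]; have [Xy|yX] := leP (X w) y; [left|right; split].
  by apply: measureU2; [exact: mI|exact/mI/mM/mI].
- move=> e e' H; rewrite QE lee_fin.
  have H' : fine (P (E `&` [set w | e < X w] `&` M)) <= q * e'.
    rewrite -lee_fin fineK; last by apply/fP/measurableI/mM/measurableI.
    apply: le_trans H; rewrite le_eqVlt; apply/orP; left; apply/eqP; congr (P _).
    by apply/seteqP; split => w /=; [case=> [[? ?] ?]|case].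
  have H0 : 0 <= fine (P (E `&` [set w | e < X w] `&` M)) by rewrite fine_ge0.
  rewrite ler_pdivrMr// (le_trans H')//.
  have e'0 : 0 <= e' by have := le_trans H0 H'; rewrite pmulr_rge0.
  apply: le_trans (_ : expR 1 * e' * (expR (-1) * q) <= _); last first.
    by rewrite ler_wpM2l// mulr_ge0// expR_ge0.
  have -> : expR 1 * e' * (expR (-1) * q) = (expR 1 * expR (-1)) * (q * e') by ring.
  by rewrite -expRD subrr expR0 mul1r.
Qed.

Theorem theorem12 (R : realType) (d m : nat -> nat)
  (hm : forall n, (1 <= m n)%N) (hd : forall n, (1 <= d n)%N)
  (hdm : ln (d n)%:R / (m n)%:R @[n --> \oo] --> (+oo : set_system R))
  (hpi : forall n, 2 * mix_weight R (m n) (d n) <= 1)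
  (disp : nat -> measure_display)
  (Omega : forall n, measurableType (disp n))
  (P : forall n, probability (Omega n) R)
  (mu : forall n, 'I_(d n) -> R)
  (eps : forall n, 'I_(m n) -> 'I_(d n) -> {RV (P n) >-> R})
  (heps : forall n, iid_errors (eps n))
  (hmu : forall n j, mu n j = 0) :
  let Y n w := observations (mu n) (eps n) w in
  (forall n i j,
     'V_(P n)[eps n i j] =
       (1 + 2 * mix_weight R (m n) (d n) * mix_shift R (m n) (d n) ^+ 2)%:E /\
     1 + 2 * mix_weight R (m n) (d n) * mix_shift R (m n) (d n) ^+ 2 = 2) /\
  (let T n w := TG (Y n w) in
   ~ cvg_in_distribution (fun n => P n) T (@unif01 R) /\
   cvg0_on_event (fun n => P n) T (expR (-1))) /\
  (forall (k : nat) (j : forall n, 'I_(d n)) (s : R),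
     (\forall n \near \oo, j n = k :> nat) ->
     s = 1 \/ s = -1 ->
     let M n := [set w | selects (Y n w) (j n) s] in
     let T n w := TG_selected (j n) s (Y n w) in
     ~ cvg_in_distribution (fun n => cond_prob (P n) (M n)) T (@unif01 R) /\
     cvg0_on_event (fun n => cond_prob (P n) (M n)) T (expR (-1))).
Proof.
move=> Y.
have dpos n : (0 < d n)%N := hd n.
have /choice[x hx] n : exists x : R, 0 <= x /\
    (m n)%:R * mix_shift R (m n) (d n) <= x /\
    column_law (m n) (d n) `[x, +oo[ = ((2 * (d n)%:R)^-1)%:E.
  have [x Bx qx] := column_law_quantile (heps n) (hpi n) (hm n) (Ordinal (dpos n)).
  by exists x; split => //; rewrite (le_trans _ Bx)// mulr_ge0// sqrtr_ge0.
have p1 : expR (-1) <= 1 :> R by rewrite -[leRHS]expR0 ler_expR lerN10.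
(* Uniform in [b] and [j]: the unconditional case sums over all models, and the conditional one uses
   an index [j n] that comes with [n]. *)
have rare (e e' : R) : 0 < e -> 0 < e' -> \forall n \near \oo, forall b j,
    (P n [set w | [/\ x n <= signed_sum (eps n) b j w,
       rest_max (eps n) j w <= signed_sum (eps n) b j w
     & e < TG_selected j ((-1) ^+ b) (Y n w)]]%R <= ((2 * (d n)%:R)^-1 * e')%:E)%E.
  move=> e0 e'0; have [V HV] := selected_extreme_le e0 e'0.
  have /cvgryPge/(_ V) := hdm; apply: filterS => n Vn b j.
  have [_ [Bx qx]] := hx n.
  exact: (HV _ _ _ _ _ _ _ (heps n) (hpi n) (hm n) (hmu n) Vn b j _ Bx qx).
split.
  move=> n i j; split; last exact: mix_variance.
  exact: error_variance (hpi n) ((heps n).1 i j).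
split.
- apply: (vanishing_on_event (E := fun n => some_extreme (eps n) (x n))) => //.
  + move=> n y; have mE := measurable_some_extreme (eps n) (x n).
    have mT : measurable [set w | y < TG (Y n w)].
      exact: (measurable_TG_gt (eps n) (hm n) (hmu n) y (dpos n)).
    have mTle : measurable [set w | TG (Y n w) <= y].
      have -> : [set w | TG (Y n w) <= y] = ~` [set w | y < TG (Y n w)].
        by apply/seteqP; split => w /=; rewrite leNgt => /negP.
      exact: measurableC.
    apply: le_trans (measureU2 _ mTle (measurableI _ _ mE mT)).
    apply: le_measure; rewrite ?inE//; first by apply: measurableU => //; exact: measurableI.
    by move=> w Ew; have [Ty|yT] := leP (TG (Y n w)) y; [left|right].
  + by move=> n; exact: measurable_some_extreme.
  + by move=> n; have [x0 [_ qx]] := hx n; exact: (some_extreme_ge (heps n) (hpi n) (hm n)).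
  + move=> e e' e0 e'0; apply: filterS (rare e e' e0 e'0) => n.
    exact: (some_extreme_TG_gt_le (hm n) (hmu n) (dpos n)).
move=> k j s _ hs M X.
have {hs} [b sb] : exists b : bool, s = (-1) ^+ b.
  by case: hs => ->; [exists false|exists true].
have H n := let: conj x0 (conj _ qx) := hx n in
  TG_selected_conditional b (j n) (heps n) (hpi n) (hm n) (hmu n) x0 qx.
rewrite {}/M {}/X {}sb.
apply: (vanishing_on_event (E := fun n => [set w | x n <= signed_sum (eps n) b (j n) w])) => //.
- by move=> n A; rewrite lee_fin divr_ge0// fine_ge0.
- by move=> n y; have [_ + _] := H n; exact.
- by move=> n; apply: measurable_le_set => //; exact: measurable_signed_sum.
- by move=> n; have [] := H n.
- move=> e e' e0 e'0.
  (* Compensates the factor [expR 1] lost by conditioning. *)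
  have e''0 : 0 < e' / expR 1 by rewrite divr_gt0// expR_gt0.
  apply: filterS (rare e _ e0 e''0) => n re.
  have [_ _ /(_ e _ (re b (j n)))] := H n.
  by rewrite mulrCA mulfV ?mulr1// gt_eqF// expR_gt0.
Qed.
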